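(* Let $(M,J,\omega)$ be a Vaisman manifold and let $t\in\mathbb{R}$. Then $d\,\mathrm{Ric}^{t,2}=0$ if and only if $t=-1$.
   Context: Let $(M,J,g)$ be a connected Hermitian manifold of complex dimension $n\geq2$, with fundamental form $\omega=g(J\cdot,\cdot)$. It is locally conformally K\''ahler (lcK) if $d\omega=\theta\wedge\omega$ for a closed real 1-form $\theta$, the Lee form. $\theta^\sharp$ is the $g$-dual vector field of $\theta$ and $\nabla^g$ the Levi-Civita connection. A Vaisman manifold is here an lcK manifold with $\nabla^g\theta=0$ and $\theta\neq0$ (i.e. non-K\''ahler). For $t\in\mathbb{R}$, the Gauduchon connection $\nabla^t$ is Gauduchon's canonical Hermitian connection of parameter $t$ ($t=1$: Chern; $t=-1$: Bismut); for an lcK metric it is $$\nabla^t_XY=\nabla^g_XY-\tfrac{t}{2}\theta(JX)JY+\tfrac{t-1}{4}\theta(JY)JX+\tfrac{t-1}{4}\omega(X,Y)J\theta^\sharp-\tfrac{t+1}{4}\theta(Y)X+\tfrac{t+1}{4}g(X,Y)\theta^\sharp .$$ With curvature $R^{\nabla}_{X,Y}=[\nabla_X,\nabla_Y]-\nabla_{[X,Y]}$ and a $g$-orthonormal basis $e_1,\dots,e_{2n}$, the second Gauduchon--Ricci form is $$\mathrm{Ric}^{t,2}(X,Y)=-\tfrac12\sum_{i=1}^{2n}g(R^{\nabla^t}_{e_i,Je_i}X,Y).$$ *)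

(* Defs.v *)
From mathcomp Require Import all_boot all_order all_algebra.
From mathcomp Require Import all_classical all_reals all_analysis.

Set Implicit Arguments.
Unset Strict Implicit.
Unset Printing Implicit Defensive.

Import Order.TTheory GRing.Theory Num.Theory.
Import numFieldNormedType.Exports.

Local Open Scope classical_set_scope.
Local Open Scope ring_scope.

(* Manifolds are given by atlases of holomorphic charts with values in
   C^n = R^n x R^n, whose points (x, y) = x + i y are row vectors of length
   n + n.  Tensor fields are families of coordinate expressions, one for each
   chart, related by the Jacobians of the transition maps. *)

Section Smoothness.
Context {R : realType} {V W : normedModType R}.

Definition iter_derive (s : seq V) (f : V -> W) : V -> W :=
  foldr (fun v h => 'D_v h) f s.

(* f is C^oo on the open set U *)
Definition smooth_on (U : set V) (f : V -> W) : Prop :=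
  forall (s : seq V) (x : V), U x -> differentiable (iter_derive s f) x.

End Smoothness.

Section ComplexStructure.
Context {R : realType} {n : nat}.
Local Notation V := 'rV[R]_(n + n).

(* multiplication by i: (x, y) |-> (- y, x) *)
Definition J (u : V) : V := row_mx (- rsubmx u) (lsubmx u).

(* the second condition is the system of Cauchy-Riemann equations *)
Definition holomorphic_on (U : set V) (f : V -> V) : Prop :=
  smooth_on U f /\ forall x u : V, U x -> 'D_(J u) f x = J ('D_u f x).

End ComplexStructure.

Record complex_atlas (R : realType) (n : nat) (M : topologicalType) := {
  chart : Type;
  dom : chart -> set M;
  coord : chart -> M -> 'rV[R]_(n + n);
  param : chart -> 'rV[R]_(n + n) -> M;
  dom_open : forall c, open (dom c);
  dom_cover : forall p, exists c, dom c p;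
  cod_open : forall c, open (coord c @` dom c);
  coordK : forall c p, dom c p -> param c (coord c p) = p;
  coord_continuous : forall c, {within dom c, continuous (coord c)};
  param_continuous :
    forall c, {within coord c @` dom c, continuous (param c)};
  transition_holomorphic : forall c c',
    holomorphic_on (coord c @` (dom c `&` dom c')) (coord c' \o param c) }.

(* Euclidean-coordinate formulas, on an open subset of R^n x R^n. *)
Section LocalGeometry.
Context {R : realType} {n : nat}.
Local Notation V := 'rV[R]_(n + n).
Implicit Types (G : V -> 'M[R]_(n + n)) (theta : V -> V) (X Y Z : V -> V).
Implicit Types (x u v w : V).

Definition inner (B : 'M[R]_(n + n)) u v : R := (u *m B *m v^T) 0 0.

Definition eval1 (a u : V) : R := (u *m a^T) 0 0.

(* omega = g(J ., .) *)
Definition fundamental G x u v : R := inner (G x) (J u) v.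

(* exterior derivative of a 1-form and of a 2-form, on constant vector fields *)
Definition d1 theta x u v : R :=
  'D_u (fun y => eval1 (theta y) v) x - 'D_v (fun y => eval1 (theta y) u) x.

Definition d2 (rho : V -> V -> V -> R) x u v w : R :=
  'D_u (fun y => rho y v w) x + 'D_v (fun y => rho y w u) x
  + 'D_w (fun y => rho y u v) x.

Definition wedge12 theta (rho : V -> V -> V -> R) x u v w : R :=
  eval1 (theta x) u * rho x v w + eval1 (theta x) v * rho x w u
  + eval1 (theta x) w * rho x u v.

Definition lie_bracket X Y : V -> V := fun x => 'D_(X x) Y x - 'D_(Y x) X x.

(* Gamma(u, v), obtained by raising the index of the Koszul 1-form
   w |-> (u g(v, w) + v g(u, w) - w g(u, v)) / 2 for constant u, v, w *)
Definition christoffel G x u v : V :=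
  (\row_k (2^-1 * ('D_u (fun y => inner (G y) v (delta_mx 0 k)) x
                 + 'D_v (fun y => inner (G y) u (delta_mx 0 k)) x
                 - 'D_(delta_mx 0 k) (fun y => inner (G y) u v) x)))
  *m invmx (G x).

Definition levi_civita G X Y : V -> V :=
  fun x => 'D_(X x) Y x + christoffel G x (X x) (Y x).

(* (nabla^g_u theta)(v) *)
Definition nabla_theta G theta x u v : R :=
  'D_u (fun y => eval1 (theta y) v) x
  - eval1 (theta x) (levi_civita G (cst u) (cst v) x).

Definition sharp G theta x : V := theta x *m invmx (G x).

Definition gauduchon (t : R) G theta X Y : V -> V := fun x =>
  levi_civita G X Y x
  - (t / 2 * eval1 (theta x) (J (X x))) *: J (Y x)
  + ((t - 1) / 4 * eval1 (theta x) (J (Y x))) *: J (X x)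
  + ((t - 1) / 4 * fundamental G x (X x) (Y x)) *: J (sharp G theta x)
  - ((t + 1) / 4 * eval1 (theta x) (Y x)) *: X x
  + ((t + 1) / 4 * inner (G x) (X x) (Y x)) *: sharp G theta x.

Definition curvature (nabla : (V -> V) -> (V -> V) -> V -> V) X Y Z : V -> V :=
  fun x => nabla X (nabla Y Z) x - nabla Y (nabla X Z) x
           - nabla (lie_bracket X Y) Z x.

(* some basis e_0, ..., e_{2n-1}, given by the rows of a matrix, that is
   orthonormal for B (it exists when B is symmetric positive definite) *)
Definition orthonormal_basis (B : 'M[R]_(n + n)) : 'M[R]_(n + n) :=
  xget 0 [set E : 'M[R]_(n + n) |
    forall i j, inner B (row i E) (row j E) = (i == j)%:R].

(* the curvature is a tensor: tangent vectors are extended by constant fields *)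
Definition ricci2 (t : R) G theta x u v : R :=
  - 2^-1 * \sum_i
     let e := row i (orthonormal_basis (G x)) in
     inner (G x)
       (curvature (gauduchon t G theta) (cst e) (cst (J e)) (cst u) x) v.

End LocalGeometry.

Section GlobalGeometry.
Context {R : realType} {n : nat} {M : topologicalType}.
Variable A : complex_atlas R n M.
Local Notation V := 'rV[R]_(n + n).
Implicit Types (g : chart A -> V -> 'M[R]_(n + n)) (theta : chart A -> V -> V).

Definition cod (c : chart A) : set V := coord c @` dom c.

Definition overlap (c c' : chart A) : set V := coord c @` (dom c `&` dom c').

Definition transition (c c' : chart A) : V -> V := coord c' \o param c.

Record hermitian_metric g : Prop := {
  metric_smooth : forall c, smooth_on (cod c) (g c);
  metric_tensor : forall c c' x u v, overlap c c' x ->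
    inner (g c x) u v =
    inner (g c' (transition c c' x))
      ('D_u (transition c c') x) ('D_v (transition c c') x);
  metric_sym : forall c x u v, cod c x ->
    inner (g c x) u v = inner (g c x) v u;
  metric_pos : forall c x u, cod c x -> u != 0 -> 0 < inner (g c x) u u;
  metric_J : forall c x u v, cod c x ->
    inner (g c x) (J u) (J v) = inner (g c x) u v }.

Record one_form theta : Prop := {
  form_smooth : forall c, smooth_on (cod c) (theta c);
  form_tensor : forall c c' x u, overlap c c' x ->
    eval1 (theta c x) u =
    eval1 (theta c' (transition c c' x)) ('D_u (transition c c') x) }.

(* (M, J, g) is lcK with Lee form theta *)
Record lcK g theta : Prop := {
  lcK_metric : hermitian_metric g;
  lcK_form : one_form theta;
  lcK_closed : forall c x u v, cod c x -> d1 (theta c) x u v = 0;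
  lcK_eq : forall c x u v w, cod c x ->
    d2 (fundamental (g c)) x u v w =
    wedge12 (theta c) (fundamental (g c)) x u v w }.

Record vaisman g theta : Prop := {
  vaisman_lcK : lcK g theta;
  vaisman_parallel : forall c x u v, cod c x ->
    nabla_theta (g c) (theta c) x u v = 0;
  vaisman_nonzero : exists c x, cod c x /\ theta c x != 0 }.

(* the coordinate expressions of a global 2-form *)
Definition closed_two_form (rho : chart A -> V -> V -> V -> R) : Prop :=
  forall c x u v w, cod c x -> d2 (rho c) x u v w = 0.

Definition gauduchon_ricci2 (t : R) g theta : chart A -> V -> V -> V -> R :=
  fun c => ricci2 t (g c) (theta c).

End GlobalGeometry.

(* Main.v *)
(* Let D be the Weyl connection of (g, theta); locally it is the Levi-Civita
   connection of a Kaehler metric conformal to g.  Writing nabla^t = D + A, the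
   Vaisman condition gives D theta = theta (x) theta - |theta|^2 g / 2 and
   D theta# = - |theta|^2 id / 2, from which, with s = (1 - t) / 4 and
   eta = theta o J,
     sum_i g(R^t(e_i, J e_i) u, v) = sum_i g(R^D(e_i, J e_i) u, v)
       + (4 s^2 - 4 s - t (n - 1)) d eta(u, v)
       + (n - 1) (1 + t)^2 / 4 (theta /\ eta)(u, v).
   By pair symmetry of the Kaehler curvature R^D, the first sum is
   - tr(J R^D(u, v)); in a holomorphic chart J is constant and commutes with the
   connection matrix Gam, so this is minus the exterior derivative of
   v |-> tr(J Gam(v)).  Hence d Ric^{t,2} is proportional to
   (n - 1) (1 + t)^2 d(theta /\ eta) = - (n - 1) (1 + t)^2 |theta|^2 theta /\ omega,
   and theta /\ omega is nonzero on (theta#, v, J v) for any nonzero v orthogonal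
   to theta# and J theta#, which exists because n >= 2. *)

Require Import Defs.
From HB Require Import structures.
From mathcomp Require Import all_boot all_order all_algebra.
From mathcomp Require Import all_classical all_reals all_analysis.
From mathcomp Require Import ring lra.

Set Implicit Arguments.
Unset Strict Implicit.
Unset Printing Implicit Defensive.

Import Order.TTheory GRing.Theory Num.Theory.
Import numFieldNormedType.Exports.

Local Open Scope classical_set_scope.
Local Open Scope ring_scope.

(** * Differential calculus *)

(** The orthonormal basis in [ricci2] is a pointwise choice with no continuity in the point, so d
    cannot be applied to the definition. The sum has to be brought into the basis-free form
    [ricci2E] on a whole open set before anything is differentiated. No conformal Kaehler metric is
    constructed. D is given by the Koszul formula with each derivative of g twisted by theta, so
    that D g = theta (x) g; since D theta is symmetric, R^D is skew for g itself. The first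
    derivatives of g, theta and theta# are then algebraic in the Christoffel symbols Gam of D. Thus
    R^t - R^D becomes an identity in an abstract Hermitian vector space carrying any symmetric
    product Gam that commutes with J, and there Gam cancels. The outcome is one formula for d
    Ric^{t,2} at each point, from which both implications are read off. *)

Section SecondDerivatives.
Context {R : realType} {V : normedModType R}.
Implicit Types (f : V -> R) (x u v : V).

Lemma is_derive_line f x u (a : R) : derivable f (x + a *: u) u ->
  is_derive a 1 (fun b : R => f (x + b *: u)) ('D_u f (x + a *: u)).
Proof.
have E : (fun h : R => h^-1 *: (((fun b : R => f (x + b *: u)) \o shift a) (h *: 1)
    - f (x + a *: u))) =
  (fun h : R => h^-1 *: ((f \o shift (x + a *: u)) (h *: u) - f (x + a *: u))).
  apply/funext => h /=; congr (_ *: (f _ - _)).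
  by rewrite [h *: 1]mulr1 scalerDl addrCA.
by move=> df; split; rewrite /derivable /derive E.
Qed.

Lemma MVT_line f x u (h : R) : 0 < h ->
  (forall a, a \in `[0, h] -> differentiable f (x + a *: u)) ->
  exists2 a, a \in `]0, h[ & f (x + h *: u) - f x = h * 'D_u f (x + a *: u).
Proof.
move=> h0 df.
have dl a : a \in `[0, h] ->
    is_derive a 1 (fun b : R => f (x + b *: u)) ('D_u f (x + a *: u)).
  by move=> ah; apply/is_derive_line/diff_derivable/df.
have cl : {within `[0, h], continuous (fun b : R => f (x + b *: u))}.
  by apply: derivable_within_continuous => a ah; have [] := dl a ah.
have [a ah] := MVT h0 (fun a ah => dl a (subset_itv_oo_cc ah)) cl.
by rewrite scale0r addr0 subr0 mulrC => ->; exists a.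
Qed.

Lemma derive_translate f x u v :
  'D_u (fun y => f (y + v)) x = 'D_u f (x + v).
Proof.
rewrite /derive; set F := (fun h : R => _); set G := (fun h : R => _).
suff -> : F = G by [].
by apply/funext => h; rewrite /F /G /= addrA.
Qed.

(** The mean value theorem is applied twice: along u to the increment of f in the direction v, then
    along v to the derivative of f along u. *)
Lemma second_difference f x u v (h : R) : 0 < h ->
  (forall a b, a \in `[0, h] -> b \in `[0, h] ->
     differentiable f (x + a *: u + b *: v) /\
     differentiable (fun y => 'D_u f y) (x + a *: u + b *: v)) ->
  exists a b, [/\ a \in `]0, h[, b \in `]0, h[ &
    f (x + h *: u + h *: v) - f (x + h *: u) - f (x + h *: v) + f x =
    h ^+ 2 * 'D_v (fun y => 'D_u f y) (x + a *: u + b *: v)].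
Proof.
move=> h0 df.
have h_in : h \in `[0, h] by rewrite in_itv /= lexx ltW.
have z_in : 0 \in `[0, h] by rewrite in_itv /= lexx ltW.
pose p y := f (y + h *: v) - f y.
have shift_diff a : a \in `[0, h] ->
    differentiable (fun y => f (y + h *: v)) (x + a *: u).
  move=> ah; apply: differentiable_comp; last by have [] := df _ _ ah h_in.
  by apply: differentiableD.
have fdiff a : a \in `[0, h] -> differentiable f (x + a *: u).
  by move=> ah; have := (df _ _ ah z_in).1; rewrite scale0r addr0.
have [a ah Ea] : exists2 a, a \in `]0, h[ &
    p (x + h *: u) - p x = h * 'D_u p (x + a *: u).
  apply: MVT_line => // a ah; apply: differentiableB; first exact: shift_diff.
  exact: fdiff.
have ah' := subset_itv_oo_cc ah.
have [b bh Eb] : exists2 b, b \in `]0, h[ &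
    'D_u f (x + a *: u + h *: v) - 'D_u f (x + a *: u) =
    h * 'D_v (fun y => 'D_u f y) (x + a *: u + b *: v).
  apply: (MVT_line (f := fun y => 'D_u f y)) => // b bh.
  by have [] := df _ _ ah' bh.
exists a, b; split=> //.
rewrite expr2 -mulrA -Eb.
have -> : 'D_u f (x + a *: u + h *: v) - 'D_u f (x + a *: u)
          = 'D_u p (x + a *: u).
  have -> : 'D_u p (x + a *: u) =
      'D_u (fun y => f (y + h *: v)) (x + a *: u) - 'D_u f (x + a *: u).
    apply: deriveB; apply: diff_derivable; first exact: shift_diff ah'.
    exact: fdiff ah'.
  by rewrite derive_translate.
by rewrite -Ea /p opprB addrACA [in RHS]addrC -!addrA; ring.
Qed.

(** Schwarz's argument. The second difference over a small parallelogram does not depend on the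
    order of u and v, so h^2 F at one nearby point equals h^2 G at another, and continuity of both
    at x concludes. *)
Lemma derive_comm f F G x u v (U : set V) : open U -> U x ->
  (forall y, U y -> differentiable f y) ->
  (forall y, U y -> differentiable (fun z => 'D_u f z) y) ->
  (forall y, U y -> differentiable (fun z => 'D_v f z) y) ->
  (forall y, U y -> 'D_v (fun z => 'D_u f z) y = F y) ->
  (forall y, U y -> 'D_u (fun z => 'D_v f z) y = G y) ->
  {for x, continuous F} -> {for x, continuous G} -> F x = G x.
Proof.
move=> oU Ux df du dv EF EG cu cv.
apply/eqP; rewrite -subr_eq0 -normr_eq0; apply/eqP/le_anti/andP; split => //.
apply/ler_addgt0Pl => e e0; rewrite addr0.
have e2 : 0 < e / 2 by rewrite divr_gt0.
have : \forall y \near x, [/\ U y, `|F x - F y| < e / 2 & `|G x - G y| < e / 2].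
  have nU : nbhs x U by exact: open_nbhs_nbhs.
  have nF : \forall y \near x, `|F x - F y| < e / 2.
    by move/cvgrPdist_lt : cu; apply.
  have nG : \forall y \near x, `|G x - G y| < e / 2.
    by move/cvgrPdist_lt : cv; apply.
  near=> y; split; first exact: (near nU y).
    exact: (near nF y).
  exact: (near nG y).
move=> /nbhs_ballP[d /= d0 dP].
(* The summand 1 keeps K positive when u = v = 0. With h = d / 2 / K the parallelogram spanned by h
   u and h v at x stays inside the ball of radius d. *)
pose K := `|u| + `|v| + 1.
have K0 : 0 < K by rewrite ltr_wpDl // addr_ge0.
pose h := d / 2 / K.
have h0 : 0 < h by rewrite !divr_gt0.
have dPh a b : a \in `[0, h] -> b \in `[0, h] -> 
  [/\ U (x + a *: u + b *: v), `|F x - F (x + a *: u + b *: v)| < e / 2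
    & `|G x - G (x + a *: u + b *: v)| < e / 2].
  rewrite !in_itv /= => /andP[a0 ah] /andP[b0 bh]; apply: dP.
  rewrite -ball_normE /ball_ /= -addrA opprD addNKr normrN.
  rewrite (le_lt_trans (ler_normD _ _)) // !normrZ !ger0_norm //.
  have : a * `|u| + b * `|v| <= h * (`|u| + `|v|).
    by rewrite mulrDr lerD // ler_wpM2r.
  move=> /le_lt_trans; apply.
  have hK : h * (`|u| + `|v|) + h = d / 2.
    by rewrite -[X in _ + X]mulr1 -mulrDr /h divfK // gt_eqF.
  lra.
have [a [b [ah bh Eab]]] : exists a b, [/\ a \in `]0, h[, b \in `]0, h[ &
    f (x + h *: u + h *: v) - f (x + h *: u) - f (x + h *: v) + f x =
    h ^+ 2 * F (x + a *: u + b *: v)].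
  have [|a [b [ah bh E]]] := @second_difference f x u v h h0.
    by move=> a b ah bh; have [Uy _ _] := dPh _ _ ah bh; split; [exact: df|exact: du].
  exists a, b; split=> //; rewrite E EF //.
  by have [] := dPh _ _ (subset_itv_oo_cc ah) (subset_itv_oo_cc bh).
have [b' [a' [bh' ah' Eab']]] : exists b a, [/\ b \in `]0, h[, a \in `]0, h[ &
    f (x + h *: v + h *: u) - f (x + h *: v) - f (x + h *: u) + f x =
    h ^+ 2 * G (x + b *: v + a *: u)].
  have Uc c1 c2 : c1 \in `[0, h] -> c2 \in `[0, h] -> U (x + c1 *: v + c2 *: u).
    by move=> c1h c2h; rewrite addrAC; have [] := dPh _ _ c2h c1h.
  have [|c1 [c2 [c1h c2h E]]] := @second_difference f x v u h h0.
    by move=> c1 c2 c1h c2h; have Uy := Uc _ _ c1h c2h; split; [exact: df|exact: dv].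
  exists c1, c2; split=> //; rewrite E EG //.
  exact: Uc (subset_itv_oo_cc c1h) (subset_itv_oo_cc c2h).
have [_ F1 _] := dPh _ _ (subset_itv_oo_cc ah) (subset_itv_oo_cc bh).
have [_ _ G1] := dPh _ _ (subset_itv_oo_cc ah') (subset_itv_oo_cc bh').
have FG : F (x + a *: u + b *: v) = G (x + a' *: u + b' *: v).
  apply: (mulfI (expf_neq0 2 (lt0r_neq0 h0))).
  rewrite -Eab [X in G X]addrAC -Eab'.
  by rewrite (addrAC x (h *: u)) (addrAC (f _)).
rewrite -FG in G1.
rewrite (_ : F x - G x = (F x - F (x + a *: u + b *: v))
  - (G x - F (x + a *: u + b *: v))); last by ring.
rewrite (le_trans (ler_normB _ _)) // ltW //.
rewrite (_ : e = e / 2 + e / 2); last by field.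
exact: ltrD.
Unshelve. all: by end_near.
Qed.

End SecondDerivatives.

(** * Scalar functions differentiable to a finite order *)

Section ContinuousDifferentiability.
Context {R : realType} {V : normedModType R}.
Implicit Types (f g : V -> R) (x u v : V) (U : set V).

Lemma near_eq_differentiable f g x :
  (\forall y \near x, f y = g y) -> differentiable f x -> differentiable g x.
Proof.
move=> fg df.
have fgx : f x = g x by exact: (nbhs_singleton fg).
have cd := diff_continuous df.
have E : g \o shift x = cst (g x) + 'd f x +o_ 0 id.
  have /eqaddoP Ef := diff_locally df.
  apply/eqaddoP => e e0; have := Ef e e0.
  have fg0 : \forall y \near 0, f (y + x) = g (y + x).
    by move: fg; rewrite (near_shift 0 x) /= subr0.
  apply: filter_app; apply: filterS fg0 => y fgy.
  by rewrite !fctE /= -fgy -fgx.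
by apply/diff_locallyP; rewrite (diff_unique cd E); split.
Qed.

(** The order is shifted by one: [Ck 0] already means Frechet differentiable, so [Ck 2] makes the
    second derivatives differentiable, hence continuous. Unlike [smooth_on], which quantifies over
    lists of directions, this recursion lets the product and quotient rules go through by induction
    on k. Frechet differentiability also makes derivatives linear in the direction. *)
Fixpoint Ck (k : nat) U f : Prop :=
  (forall x, U x -> differentiable f x) /\
  (if k is k'.+1 then forall v, Ck k' U (fun x => 'D_v f x) else True).

Lemma Ck_diff k U f x : Ck k U f -> U x -> differentiable f x.
Proof. by case: k => [|k] [df _] Ux; apply: (df x Ux). Qed.

Lemma Ck_derivable k U f x v : Ck k U f -> U x -> derivable f x v.
Proof. by move=> fk Ux; exact/diff_derivable/(Ck_diff fk). Qed.

Lemma Ck_derive k U f v : Ck k.+1 U f -> Ck k U (fun x => 'D_v f x).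
Proof. by case=> _ /(_ v). Qed.

Lemma CkW k U f : Ck k.+1 U f -> Ck k U f.
Proof.
elim: k f => [|k IH] f [df dvf]; split=> // v.
by apply: IH; exact: dvf.
Qed.

Lemma eq_Ck k U f g : open U -> (forall x, U x -> f x = g x) ->
  Ck k U f -> Ck k U g.
Proof.
move=> oU; elim: k f g => [|k IH] f g fg [df dvf].
all: have nfg x : U x -> \forall y \near x, f y = g y.
all: try by move=> Ux; apply: filterS (open_nbhs_nbhs (conj oU Ux)) => y; exact: fg.
all: split=> [x Ux|]; first exact: near_eq_differentiable (nfg _ Ux) (df _ Ux).
  exact: I.
move=> v; apply: (IH (fun x => 'D_v f x)) (dvf v) => x Ux.
exact: near_eq_derive (nfg x Ux).
Qed.

Lemma Ck_cst k U (a : R) : Ck k U (fun=> a).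
Proof.
elim: k a => [|k IH] a; split=> // v.
have -> : (fun x : V => 'D_v (fun=> a) x) = (fun=> 0 : R).
  by apply/funext => x; exact: derive_cst.
exact: IH.
Qed.

Lemma CkD k U f g : open U -> Ck k U f -> Ck k U g -> Ck k U (fun x => f x + g x).
Proof.
move=> oU; elim: k f g => [|k IH] f g fk gk.
all: split=> [x Ux|]; first exact: (differentiableD (Ck_diff fk Ux) (Ck_diff gk Ux)).
  exact: I.
move=> v; have := IH _ _ (Ck_derive v fk) (Ck_derive v gk).
apply: eq_Ck => // x Ux.
by rewrite -(deriveD (Ck_derivable fk Ux) (Ck_derivable gk Ux)).
Qed.

Lemma CkM k U f g : open U -> Ck k U f -> Ck k U g -> Ck k U (fun x => f x * g x).
Proof.
move=> oU; elim: k f g => [|k IH] f g fk gk.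
all: split=> [x Ux|]; first exact: (differentiableM (Ck_diff fk Ux) (Ck_diff gk Ux)).
  exact: I.
move=> v.
have := CkD oU (IH _ _ (CkW fk) (Ck_derive v gk))
  (IH _ _ (CkW gk) (Ck_derive v fk)).
apply: eq_Ck => // x Ux; apply/esym.
exact: (deriveM (Ck_derivable fk Ux) (Ck_derivable gk Ux)).
Qed.

Lemma CkN k U f : open U -> Ck k U f -> Ck k U (fun x => - f x).
Proof.
move=> oU fk; have := CkM oU (Ck_cst k U (-1)) fk.
by apply: eq_Ck => // x _; rewrite mulN1r.
Qed.

Lemma CkB k U f g : open U -> Ck k U f -> Ck k U g -> Ck k U (fun x => f x - g x).
Proof. by move=> oU fk gk; apply: CkD => //; exact: CkN. Qed.

Lemma CkV k U f : open U -> (forall x, U x -> f x != 0) ->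
  Ck k U f -> Ck k U (fun x => (f x)^-1).
Proof.
move=> oU f0; elim: k => [|k IH] fk.
all: split=> [x Ux|]; first exact: (differentiableV (Ck_diff fk Ux) (f0 x Ux)).
  exact: I.
move=> v; have fVk := IH (CkW fk).
have := CkN oU (CkM oU (CkM oU fVk fVk) (Ck_derive v fk)).
apply: eq_Ck => // x Ux.
rewrite (deriveV (f0 x Ux) (Ck_derivable fk Ux)).
by rewrite -invfM -expr2 -mulNr.
Qed.

Lemma Ck_sum k U I (r : seq I) (P : pred I) (F : I -> V -> R) : open U ->
  (forall i, Ck k U (F i)) -> Ck k U (fun x => \sum_(i <- r | P i) F i x).
Proof.
move=> oU Fk; elim: r => [|i r IH].
  by apply: eq_Ck (Ck_cst k U 0) => // x _; rewrite big_nil.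
case: (boolP (P i)) => Pi.
  by apply: eq_Ck (CkD oU (Fk i) IH) => // x _; rewrite big_cons Pi.
by apply: eq_Ck IH => // x _; rewrite big_cons (negPf Pi).
Qed.

Lemma Ck_prod k U I (r : seq I) (P : pred I) (F : I -> V -> R) : open U ->
  (forall i, Ck k U (F i)) -> Ck k U (fun x => \prod_(i <- r | P i) F i x).
Proof.
move=> oU Fk; elim: r => [|i r IH].
  by apply: eq_Ck (Ck_cst k U 1) => // x _; rewrite big_nil.
case: (boolP (P i)) => Pi.
  by apply: eq_Ck (CkM oU (Fk i) IH) => // x _; rewrite big_cons Pi.
by apply: eq_Ck IH => // x _; rewrite big_cons (negPf Pi).
Qed.

Lemma Ck_derive_comm U f x u v : open U -> Ck 2 U f -> U x ->
  'D_u (fun y => 'D_v f y) x = 'D_v (fun y => 'D_u f y) x.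
Proof.
move=> oU fk Ux.
have cont w w' :
    {for x, continuous (fun y => 'D_w (fun z => 'D_w' f z) y)}.
  apply: differentiable_continuous.
  exact: (Ck_diff (Ck_derive w (Ck_derive w' fk)) Ux).
have fdiff w y : U y -> differentiable (fun z => 'D_w f z) y.
  exact: Ck_diff (Ck_derive w fk).
apply: (derive_comm oU Ux (fun y => Ck_diff fk (x := y)) (fdiff v) (fdiff u)
  _ _ (cont u v) (cont v u)) => //.
Qed.

End ContinuousDifferentiability.

(** * Matrix-valued functions, entry by entry *)

Section MatrixValuedFunctions.
Context {R : realType} {V : normedModType R}.
Implicit Types (x u v : V) (U : set V) (p q r k : nat).

Definition Ckmx k U p q (A : V -> 'M[R]_(p, q)) : Prop :=
  forall i j, Ck k U (fun x => A x i j).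

Lemma smooth_on_derive (W : normedModType R) U (f : V -> W) v :
  smooth_on U f -> smooth_on U (fun x => 'D_v f x).
Proof.
move=> sf s x Ux; have := sf (rcons s v) x Ux.
by rewrite /iter_derive foldr_rcons.
Qed.

Lemma derive_entry p q (A : V -> 'M[R]_(p, q)) x v i j : derivable A x v ->
  'D_v A x i j = 'D_v (fun y => A y i j) x.
Proof. by move=> dA; rewrite derive_mx // mxE. Qed.

Lemma smooth_Ckmx k U p q (A : V -> 'M[R]_(p, q)) : open U ->
  smooth_on U A -> Ckmx k U A.
Proof.
move=> oU; elim: k A => [|k IH] A sA i j.
all: have dA x : U x -> differentiable A x by move=> Ux; exact: (sA [::] x Ux).
all: split=> [x Ux|].
- exact: (@differentiable_comp _ _ _ _ A (fun N => N i j) x (dA x Ux)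
    (differentiable_coord _ _ _)).
- exact: I.
- exact: (@differentiable_comp _ _ _ _ A (fun N => N i j) x (dA x Ux)
    (differentiable_coord _ _ _)).
- move=> v; have := IH _ (smooth_on_derive v sA) i j.
  apply: eq_Ck => // x Ux.
  by apply: derive_entry; apply: diff_derivable; exact: dA.
Qed.

Lemma Ckmx_derivable k U p q (A : V -> 'M[R]_(p, q)) x v :
  Ckmx k U A -> U x -> derivable A x v.
Proof. by move=> Ak Ux; apply/derivable_mxP => i j; exact: (Ck_derivable (Ak i j) Ux). Qed.

Lemma Ckmx_is_derive k U p q (A : V -> 'M[R]_(p, q)) x v :
  Ckmx k U A -> U x -> is_derive x v A ('D_v A x).
Proof. by move=> Ak Ux; apply/derivableP/(Ckmx_derivable Ak Ux). Qed.

Lemma Ckmx_derive k U p q (A : V -> 'M[R]_(p, q)) v : open U ->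
  Ckmx k.+1 U A -> Ckmx k U (fun x => 'D_v A x).
Proof.
move=> oU Ak i j; apply: eq_Ck (Ck_derive v (Ak i j)) => // x Ux.
by rewrite derive_entry //; exact: (Ckmx_derivable Ak Ux).
Qed.

Lemma Ckmx_cst k U p q (A : 'M[R]_(p, q)) : Ckmx k U (fun=> A).
Proof. by move=> i j; exact: Ck_cst. Qed.

Lemma CkmxD k U p q (A B : V -> 'M[R]_(p, q)) : open U ->
  Ckmx k U A -> Ckmx k U B -> Ckmx k U (fun x => A x + B x).
Proof.
move=> oU Ak Bk i j; apply: eq_Ck (CkD oU (Ak i j) (Bk i j)) => // x _.
by rewrite mxE.
Qed.

Lemma CkmxZ k U p q (a : V -> R) (A : V -> 'M[R]_(p, q)) : open U ->
  Ck k U a -> Ckmx k U A -> Ckmx k U (fun x => a x *: A x).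
Proof.
move=> oU ak Ak i j; apply: eq_Ck (CkM oU ak (Ak i j)) => // x _.
by rewrite mxE.
Qed.

Lemma CkmxB k U p q (A B : V -> 'M[R]_(p, q)) : open U ->
  Ckmx k U A -> Ckmx k U B -> Ckmx k U (fun x => A x - B x).
Proof.
move=> oU Ak Bk i j; apply: eq_Ck (CkB oU (Ak i j) (Bk i j)) => // x _.
by rewrite !mxE.
Qed.

Lemma Ckmx_mul k U p q r (A : V -> 'M[R]_(p, q)) (B : V -> 'M[R]_(q, r)) :
  open U -> Ckmx k U A -> Ckmx k U B -> Ckmx k U (fun x => A x *m B x).
Proof.
move=> oU Ak Bk i j.
apply: (@eq_Ck _ _ _ _ (fun x => \sum_l A x i l * B x l j)) => //.
  by move=> x _; rewrite mxE.
by apply: Ck_sum => // l; exact: CkM.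
Qed.

Lemma Ck_det k U p (A : V -> 'M[R]_p) : open U ->
  Ckmx k U A -> Ck k U (fun x => \det (A x)).
Proof.
move=> oU Ak; apply: Ck_sum => // s; apply: CkM => //; first exact: Ck_cst.
by apply: Ck_prod => // i; exact: Ak.
Qed.

(** By Cramer's rule the entries of the inverse are cofactors divided by the determinant, so the
    scalar rules suffice. *)
Lemma Ckmx_inv k U p (A : V -> 'M[R]_p) : open U ->
  (forall x, U x -> A x \in unitmx) ->
  Ckmx k U A -> Ckmx k U (fun x => invmx (A x)).
Proof.
move=> oU uA Ak i j.
have detV : Ck k U (fun x => (\det (A x))^-1).
  apply: CkV => //; last exact: Ck_det.
  by move=> x /uA; rewrite unitmxE unitfE.
have cof : Ck k U (fun x => cofactor (A x) j i).
  apply: CkM => //; first exact: Ck_cst.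
  apply: Ck_det => // a b; apply: eq_Ck (Ak (lift j a) (lift i b)) => // x _.
  by rewrite !mxE.
apply: eq_Ck (CkM oU detV cof) => // x /uA Ax.
by rewrite /invmx Ax !mxE.
Qed.

Lemma is_derive_mulmx p q r (A : V -> 'M[R]_(p, q)) (B : V -> 'M[R]_(q, r))
    x v dA dB : is_derive x v A dA -> is_derive x v B dB ->
  is_derive x v (fun y => A y *m B y) (dA *m B x + A x *m dB).
Proof.
move=> [cA <-] [cB <-].
have ent i j : is_derive x v (fun y => (A y *m B y) i j)
    (('D_v A x *m B x + A x *m 'D_v B x) i j).
  have -> : (fun y => (A y *m B y) i j) =
      \sum_(l < q) ((fun y => A y i l) * (fun y => B y l j)).
    by apply/funext => y; rewrite mxE fct_sumE.
  have dl (l : 'I_q) := is_deriveM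
    (derivableP ((derivable_mxP A x v).1 cA i l))
    (derivableP ((derivable_mxP B x v).1 cB l j)).
  apply: is_derive_eq (is_derive_sum dl) _.
  rewrite !mxE -big_split /=; apply: eq_bigr => l _.
  rewrite (derive_entry _ _ cA) (derive_entry _ _ cB) [RHS]addrC.
  by congr (_ + _); exact: mulrC.
have dAB : derivable (fun y => A y *m B y) x v.
  by apply/derivable_mxP => i j; case: (ent i j).
split=> //; apply/matrixP => i j.
by rewrite derive_entry //; case: (ent i j).
Qed.

Lemma Ckmx_derive_comm U p q (A : V -> 'M[R]_(p, q)) x u v : open U ->
  Ckmx 2 U A -> U x ->
  'D_u (fun y => 'D_v A y) x = 'D_v (fun y => 'D_u A y) x.
Proof.
move=> oU Ak Ux; apply/matrixP => i j.
have D2 w w' : 'D_w (fun y => 'D_w' A y) x i j =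
    'D_w (fun y => 'D_w' (fun z => A z i j) y) x.
  rewrite derive_entry; last exact: (Ckmx_derivable (Ckmx_derive w' oU Ak) Ux).
  apply: near_eq_derive; apply: filterS (open_nbhs_nbhs (conj oU Ux)) => y Uy.
  by rewrite derive_entry //; exact: (Ckmx_derivable Ak Uy).
have C := @Ck_derive_comm _ _ U (fun z => A z i j) x u v oU (Ak i j) Ux.
exact: etrans (D2 u v) (etrans C (esym (D2 v u))).
Qed.

Lemma Ckmx_derive_linear k U p q (A : V -> 'M[R]_(p, q)) x (a : R) u v :
  Ckmx k U A -> U x -> 'D_(a *: u + v) A x = a *: 'D_u A x + 'D_v A x.
Proof.
move=> Ak Ux; apply/matrixP => i j.
have dA w : derivable A x w by exact: (Ckmx_derivable Ak Ux).
have df := Ck_diff (Ak i j) Ux.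
rewrite !mxE !derive_entry // !deriveE //.
by rewrite linearP.
Qed.

End MatrixValuedFunctions.

(** * Linear algebra of Hermitian forms *)

Section OrthonormalBases.
Context {R : rcfType}.

(** Gram-Schmidt in block form, by induction on the dimension: one pivot is split off by a
    congruence and the rest is handled by the induction hypothesis. *)
Lemma posdef_orthonormal m (B : 'M[R]_m) : B^T = B ->
  (forall u : 'rV[R]_m, u != 0 -> 0 < (u *m B *m u^T) 0 0) ->
  exists E : 'M[R]_m, E *m B *m E^T = 1%:M.
Proof.
elim: m B => [|m IH] B symB posB.
  by exists 0; apply/matrixP => -[].
change 'M[R]_(1 + m) in B.
pose a := B 0 0; pose b := ursubmx B; pose C := drsubmx B.
have EB : B = block_mx a%:M b b^T C.
  rewrite -[LHS]submxK; congr (block_mx _ _ _ _).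
    by rewrite [LHS]mx11_scalar mxE lshift0 mxE lshift0.
  by rewrite -[in LHS]symB trmx_ursub.
have a0 : 0 < a.
  have := posB (delta_mx 0 0); rewrite -rowE trmx_delta -colE !mxE; apply.
  by apply/eqP => /matrixP/(_ 0 0); rewrite !mxE !eqxx => /eqP; rewrite oner_eq0.
(* S is the Schur complement of the pivot a, and L the row operation whose congruence clears the
   first row and column. S is again positive definite, being the form B on the vectors [u *m L] with
   u = (0, w). *)
pose S := C - a^-1 *: (b^T *m b).
pose L : 'M[R]_(1 + m) := block_mx 1%:M 0 (- a^-1 *: b^T) 1%:M.
have LBL : L *m B *m L^T = block_mx a%:M 0 0 S.
  rewrite EB /L tr_block_mx !mulmx_block.
  rewrite !trmx0 !trmx1 !mul1mx !mul0mx !mulmx1 !mulmx0 !addr0.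
  rewrite linearZ /= trmxK.
  have -> : (- a^-1 *: b^T) *m a%:M + b^T = 0.
    by rewrite mul_mx_scalar scalerA mulrN divff ?gt_eqF // scaleN1r addNr.
  have -> : a%:M *m (- a^-1 *: b) + b = 0.
    by rewrite mul_scalar_mx scalerA mulrN divff ?gt_eqF // scaleN1r addNr.
  by rewrite mul0mx add0r -scalemxAl scaleNr addrC.
have [||F FSF] := IH S.
- by rewrite /S linearB linearZ /= trmx_mul trmxK /C -[in RHS]symB trmx_drsub.
- move=> w w0; pose u : 'rV[R]_(1 + m) := row_mx 0 w.
  have : (u *m (L *m B *m L^T) *m u^T) 0 0 = (w *m S *m w^T) 0 0.
    rewrite LBL mul_row_block tr_row_mx mul_row_col !mul0mx !mulmx0.
    by rewrite trmx0 mulmx0 !add0r.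
  move=> <-; rewrite !mulmxA -mulmxA -trmx_mul; apply: posB.
  apply/eqP => uL; case/eqP: w0.
  have := congr1 (@rsubmx _ 1 1 m) uL; rewrite mul_row_block row_mxKr mulmx0 mulmx1 add0r.
  by move=> ->; apply/rowP => i; rewrite !mxE.
pose D : 'M[R]_(1 + m) := block_mx (Num.sqrt a)^-1%:M 0 0 F.
exists (D *m L); rewrite trmx_mul.
rewrite (_ : _ *m _ *m _ = D *m (L *m B *m L^T) *m D^T); last first.
  by rewrite !mulmxA.
rewrite LBL tr_block_mx !mulmx_block !trmx0 !mul0mx !mulmx0 !addr0 !add0r FSF.
rewrite !mul0mx tr_scalar_mx -!scalar_mxM (_ : _ * a * _ = 1).
  exact: (esym (scalar_mx_block 1 m 1)).
have sa0 : Num.sqrt a != 0 by rewrite sqrtr_eq0 -ltNge.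
by rewrite -{2}(sqr_sqrtr (ltW a0)) expr2 mulKf // divff.
Qed.

End OrthonormalBases.

Section HermitianLinearAlgebra.
Context {R : realFieldType} {V : lmodType R} (J : {linear V -> V}).
Context (g : V -> V -> R).
Hypothesis gC : forall u v, g u v = g v u.
Hypothesis gDl : forall u v w, g (u + v) w = g u w + g v w.
Hypothesis gZl : forall a u w, g (a *: u) w = a * g u w.
Hypothesis JK : forall u, J (J u) = - u.
Hypothesis gJ : forall u v, g (J u) (J v) = g u v.

Lemma gDr u v w : g u (v + w) = g u v + g u w.
Proof. by rewrite !(gC u) gDl. Qed.

Lemma gZr a u w : g u (a *: w) = a * g u w.
Proof. by rewrite !(gC u) gZl. Qed.

Lemma gNl u w : g (- u) w = - g u w.
Proof. by rewrite -scaleN1r gZl mulN1r. Qed.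

Lemma gNr u w : g u (- w) = - g u w.
Proof. by rewrite !(gC u) gNl. Qed.

Lemma gJl u w : g (J u) w = - g u (J w).
Proof. by rewrite -gJ JK gNl. Qed.

Lemma gJr u w : g u (J w) = - g w (J u).
Proof. by rewrite gC gJl. Qed.

Lemma gJ0 u : g u (J u) = 0.
Proof. by have := gJr u u; lra. Qed.

Lemma J_add u v : J (u + v) = J u + J v. Proof. exact: linearD. Qed.
Lemma J_opp u : J (- u) = - J u. Proof. exact: linearN. Qed.
Lemma J_scale a u : J (a *: u) = a *: J u. Proof. exact: linearZ. Qed.

Let gE := (gDl, gDr, gZl, gZr, gNl, gNr, gJl, J_add, J_opp, J_scale, JK).

(** * Curvature of nabla^t compared with that of D, as pointwise algebra *)

Section GauduchonDifference.
Variables (t : R) (T : V) (Gam : V -> V -> V).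
Hypothesis GamC : forall u v, Gam u v = Gam v u.
Hypothesis GamD : forall u v w, Gam u (v + w) = Gam u v + Gam u w.
Hypothesis GamZ : forall a u v, Gam u (a *: v) = a *: Gam u v.
Hypothesis GamJ : forall u v, Gam u (J v) = J (Gam u v).

Let s := (1 - t) / 4.
Let l := g T T.

(** For fixed e this endomorphism of u is skew for g and commutes with J. The factor s in front of
    it vanishes exactly for the Chern connection, t = 1. *)
Definition lee_part e u : V :=
  g T u *: e - g e u *: T - g T (J u) *: J e - g (J e) u *: J T.

Definition gauduchon_part e u : V :=
  (g T e / 2) *: u - (t / 2 * g T (J e)) *: J u + s *: lee_part e u.

(* The derivatives of the metric, of the Lee form and of its dual vector field
   along a vector e, as dictated by the Weyl connection Gam. *)
Definition dg e u v := g (Gam e u) v + g u (Gam e v) + g T e * g u v.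
Definition dtheta e u := g T (Gam e u) + g T e * g T u - l / 2 * g e u.
Definition dsharp e := - Gam e T - (l / 2) *: e.

(** The product rule for the derivative along e of [lee_part f u], with f, u and J constant;
    [is_derive_gauduchon_part] confirms that these formal expressions are the actual derivatives. *)
Definition d_lee_part e f u : V :=
  dtheta e u *: f - (dg e f u *: T + g f u *: dsharp e) - dtheta e (J u) *: J f
  - (dg e (J f) u *: J T + g (J f) u *: J (dsharp e)).

Definition d_gauduchon_part e f u : V :=
  (dtheta e f / 2) *: u - (t / 2 * dtheta e (J f)) *: J u
  + s *: d_lee_part e f u.

(** Those terms of nabla^t_e nabla^t_f u, for constant f and u, that involve A = nabla^t - D. *)
Definition curvature_part e f u : V :=
  d_gauduchon_part e f u + Gam e (gauduchon_part f u)
  + gauduchon_part e (Gam f u) + gauduchon_part e (gauduchon_part f u).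

Lemma GamN u v : Gam u (- v) = - Gam u v.
Proof. by rewrite -scaleN1r GamZ scaleN1r. Qed.

Lemma lee_partD e u v : lee_part e (u + v) = lee_part e u + lee_part e v.
Proof.
rewrite /lee_part J_add !gDr !scalerDl !opprD.
by rewrite (addrACA (_ *: e)) (addrACA (_ - _)) (addrACA (_ - _ - _)).
Qed.

Lemma lee_partZ a e u : lee_part e (a *: u) = a *: lee_part e u.
Proof. by rewrite /lee_part J_scale !gZr !scalerBr !scalerA. Qed.

Lemma lee_partN e u : lee_part e (- u) = - lee_part e u.
Proof. by rewrite -scaleN1r lee_partZ scaleN1r. Qed.

Lemma lee_partJ e u : lee_part e (J u) = J (lee_part e u).
Proof.
rewrite /lee_part !(J_add, J_opp, J_scale, JK) gJ gJl gNr !scaleNr scalerN.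
by rewrite !opprK scalerN -[LHS]addrA [LHS]addrC !addrA.
Qed.

(** The left side is the covariant derivative along e, for D, of the tensor [lee_part]. Since D J =
    0 and D g, D theta, D theta# are algebraic in theta and g, so is this derivative, and Gam
    disappears. *)
Lemma lee_part_parallel e f u v :
  g (d_lee_part e f u + Gam e (lee_part f u)
     - lee_part (Gam e f) u - lee_part f (Gam e u)) v =
  g T e * g (lee_part f u) v
  + l / 2 * (g f u * g e v - g e u * g f v
             + g (J f) u * g (J e) v - g (J e) u * g (J f) v).
Proof.
rewrite /d_lee_part /dtheta /dg /dsharp /lee_part.
rewrite !(GamD, GamN, GamZ, GamJ) !gE -/l.
ring.
Qed.

(** R^t - R^D is d^D A + [A, A]. The first two terms of A are multiples of the identity and of J,
    hence commute with [lee_part]: they contribute d theta / 2 = 0 and -(t / 2) d eta times J. The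
    bracket therefore reduces to the s^2 term. *)
Lemma curvature_difference e f u v :
  g (curvature_part e f u - curvature_part f e u) v =
  - (t / 2 * (g T e * g T (J f) - g T f * g T (J e) + l * g (J e) f) * g (J u) v)
  + s * (g T e * g (lee_part f u) v - g T f * g (lee_part e u) v
         + l * (g f u * g e v - g e u * g f v
                + g (J f) u * g (J e) v - g (J e) u * g (J f) v))
  + s ^+ 2 * (g (lee_part e (lee_part f u)) v - g (lee_part f (lee_part e u)) v).
Proof.
move: (lee_part_parallel e f u v) (lee_part_parallel f e u v).
move: lee_partD lee_partN lee_partZ lee_partJ.
rewrite /curvature_part /d_gauduchon_part /gauduchon_part /dtheta.
move: lee_part d_lee_part => L dL LD LN LZ LJ P1 P2.
rewrite !(gDl, gNl) ?gJl in P1 P2.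
rewrite !(GamD, GamN, GamZ, GamJ) !(LD, LN, LZ, LJ).
rewrite ?(J_add, J_opp, J_scale, JK) !(gDl, gNl, gZl).
(* [lee_part_parallel] is solved for the derivative of [lee_part]. After substitution the terms in
   Gam cancel, those containing Gam e f by its symmetry. *)
have solve (a b c d y : R) : a + b - c - d = y -> a = y + d + c - b.
  by move=> <-; ring.
rewrite (solve _ _ _ _ _ P1) (solve _ _ _ _ _ P2) !gJl (GamC f e).
rewrite ?(gC f e) ?(gJr f e).
by field.
Qed.

(** Arranged so that e occurs only in products g(e, a) g(e, b) or in g(e, e), the two shapes whose
    sums over an orthonormal basis are known. *)
Lemma curvature_difference_J e u v :
  g (curvature_part e (J e) u - curvature_part (J e) e u) v =
  t / 2 * g (J u) v * (g e T * g e T)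
  + t / 2 * g (J u) v * (g e (J T) * g e (J T))
  - t / 2 * l * g (J u) v * g e e
  + s * g T (J u) * (g e T * g e v) - s * g T u * (g e T * g e (J v))
  + s * g T v * (g e T * g e (J u)) - s * g T (J v) * (g e T * g e u)
  + s * g T u * (g e (J T) * g e v) + s * g T (J u) * (g e (J T) * g e (J v))
  - s * g T v * (g e (J T) * g e u) - s * g T (J v) * (g e (J T) * g e (J u))
  + (s - s ^+ 2) * 2 * l * (g e u * g e (J v))
  - (s - s ^+ 2) * 2 * l * (g e (J u) * g e v)
  + s ^+ 2 * 2 * (g T u * g T (J v) - g T (J u) * g T v) * g e e.
Proof.
rewrite curvature_difference /lee_part !gE -/l.
rewrite ?(gC e T) ?(gC u T) ?(gC v T) ?(gC u e) ?(gC v e).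
rewrite ?(gJr e T) ?(gJr u T) ?(gJr v T) ?(gJr u e) ?(gJr v e) ?gJ0.
by field.
Qed.

(** Parseval gives l omega the coefficient 4 s^2 - 4 s - (t / 2) (N - 2) and theta /\ eta the
    coefficient 2 N s^2 - 4 s. Their difference is (N - 2) (2 s^2 + t / 2), and 2 s^2 + t / 2 = (1 +
    t)^2 / 8; the common part is grouped into d eta, which is exact. *)
Lemma curvature_difference_trace (I : finType) (E : I -> V) (N : R) u v :
  (forall a b, \sum_i g (E i) a * g (E i) b = g a b) ->
  \sum_i g (E i) (E i) = N ->
  \sum_i g (curvature_part (E i) (J (E i)) u - curvature_part (J (E i)) (E i) u) v =
  (4 * s ^+ 2 - 4 * s - t / 2 * (N - 2)) *
    (g T u * g T (J v) - g T (J u) * g T v + l * g (J u) v)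
  + (N - 2) * (1 + t) ^+ 2 / 8 * (g T u * g T (J v) - g T (J u) * g T v).
Proof.
move=> parseval EN.
rewrite (eq_bigr _ (fun i _ => curvature_difference_J (E i) u v)).
rewrite !(big_split, sumrN) /= -!mulr_sumr !parseval EN !gE -/l.
rewrite ?(gC u T) ?(gC v T) ?(gC v u).
rewrite ?(gJr u T) ?(gJr v T) ?(gJr v u) ?gJ0 /s.
by field.
Qed.

(** As J is constant in a holomorphic chart, the left side is d eta(u, v); hence d eta = theta /\
    eta + l omega. *)
Lemma dtheta_J_alternate u v :
  dtheta u (J v) - dtheta v (J u) =
  g T u * g T (J v) - g T (J u) * g T v + l * g (J u) v.
Proof.
rewrite /dtheta !GamJ (GamC v u) (gJr v u) gJl -/l.
by field.
Qed.

(** The left side is d(theta /\ eta)(u, v, w). It equals - theta /\ d eta because d theta = 0, and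
    only the part l omega of d eta survives the product with theta. *)
Lemma dtheta_wedge u v w (D := fun e a b => dtheta e a * g T b + g T a * dtheta e b) :
  (D u v (J w) - D u (J v) w) + (D v w (J u) - D v (J w) u)
  + (D w u (J v) - D w (J u) v) =
  - l * (g T u * g (J v) w + g T v * g (J w) u + g T w * g (J u) v).
Proof.
rewrite /D /dtheta !GamJ (GamC v u) (GamC w u) (GamC w v) !gJl -/l.
rewrite (gC v u) (gC w u) (gC w v) (gJr v u) (gJr w u) (gJr w v).
by field.
Qed.

End GauduchonDifference.

(* The octahedron argument: add up the Bianchi identities for the four cyclic
   permutations of (a, b, c, d). *)
Lemma curvature_pair_symmetry (rm : V -> V -> V -> V -> R) :
  (forall a b c d, rm a b c d = - rm b a c d) ->
  (forall a b c d, rm a b c d = - rm a b d c) ->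
  (forall a b c d, rm a b c d + rm b c a d + rm c a b d = 0) ->
  forall a b c d, rm a b c d = rm c d a b.
Proof.
move=> sk1 sk2 bianchi a b c d.
have := bianchi a b c d; have := bianchi b c d a.
have := bianchi c d a b; have := bianchi d a b c.
rewrite (sk1 d a b c) (sk2 a d b c) (sk2 a b d c) (sk1 b d a c) (sk2 d b a c).
rewrite (sk1 d b c a).
rewrite (sk2 c d b a) (sk1 d a c b) (sk1 a c d b) (sk2 c a d b).
rewrite (sk2 b c d a) (sk2 a d c b).
lra.
Qed.

End HermitianLinearAlgebra.

Lemma sub_add_sub_opp (V : zmodType) (a b c d : V) :
  a - b + c - d = - (b - a + d - c).
Proof. by rewrite opprB opprD opprB [RHS]addrC addrAC. Qed.

Lemma sub_add_sub_cyclic (V : zmodType) (a b c p q r : V) :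
  (a - b + p - q) + (b - c + q - r) + (c - a + r - p) = 0.
Proof.
have E (x y z w : V) : x - y + z - w = (x + z) - (y + w).
  by rewrite -addrA addrACA -opprD.
rewrite (E a) (E b) (E c); move: (a + p) (b + q) (c + r) => A B C.
by rewrite !addrA !subrK subrr.
Qed.

(** * The Koszul formula twisted by the Lee form *)

Section WeylAlgebra.
Context {R : realFieldType} {V : lmodType R} (J : {linear V -> V}).
Context (g : V -> V -> R) (th : V -> R) (K : V -> V -> V -> R) (Gam : V -> V -> V).
Hypothesis gC : forall u v, g u v = g v u.
Hypothesis gDl : forall u v w, g (u + v) w = g u w + g v w.
Hypothesis gZl : forall a u w, g (a *: u) w = a * g u w.
Hypothesis JK : forall u, J (J u) = - u.
Hypothesis gJ : forall u v, g (J u) (J v) = g u v.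
Hypothesis g_inj : forall u v, (forall w, g u w = g v w) -> u = v.
Hypothesis thP : forall c u v, th (c *: u + v) = c * th u + th v.
Hypothesis KPl : forall c u v a b, K (c *: u + v) a b = c * K u a b + K v a b.
Hypothesis KPm : forall e c u v w, K e (c *: u + v) w = c * K e u w + K e v w.
Hypothesis KC : forall e u v, K e u v = K e v u.
Hypothesis KJ : forall e u v, K e (J u) (J v) = K e u v.
Hypothesis GamE : forall u v w, g (Gam u v) w =
  2^-1 * ((K u v w - th u * g v w) + (K v u w - th v * g u w)
          - (K w u v - th w * g u v)).

(** [K e u v] plays the role of the derivative of g(u, v) along e. Linearity of the Koszul
    expression in its last argument is what allows it to be represented by a vector. *)
Lemma koszul_form_linear u v c a b (F : V -> R) :
  (forall w, F w = 2^-1 * (K u v w + K v u w - K w u v)) ->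
  F (c *: a + b) = c * F a + F b.
Proof.
move=> FE; rewrite !FE KPl !(KC _ _ (c *: a + b)) !KPm !(KC _ a) !(KC _ b).
by ring.
Qed.

Lemma koszul_sym u v : Gam u v = Gam v u.
Proof. by apply: g_inj => w; rewrite !GamE (KC w v u) (gC v u); ring. Qed.

Lemma koszul_linear c u v w : Gam u (c *: v + w) = c *: Gam u v + Gam u w.
Proof.
apply: g_inj => z; rewrite gDl gZl !GamE KPl KPm thP gDl gZl.
by rewrite (KC z u) KPm !(KC z _ u) !(gC u) gDl gZl; ring.
Qed.

Lemma koszul_metric e u v :
  K e u v = g (Gam e u) v + g u (Gam e v) + th e * g u v.
Proof.
rewrite (gC u (Gam _ _)) !GamE (KC e v u) (KC v e u) (KC u e v).
by rewrite ?(gC v u) ?(gC u e) ?(gC v e); field.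
Qed.

(* The classical argument that a Hermitian metric with closed fundamental form
   and integrable complex structure is Kaehler; here everything is twisted by
   the Lee form. *)
Lemma koszul_J u v :
  (forall a b c, K a (J b) c + K b (J c) a + K c (J a) b =
     th a * g (J b) c + th b * g (J c) a + th c * g (J a) b) ->
  Gam u (J v) = J (Gam u v).
Proof.
move=> lck; apply: g_inj => w.
have gJl a b : g (J a) b = - g a (J b) by exact: gJl.
have gN a b : g a (- b) = - g a b by exact: gNr.
have KN e a b : K e (- a) b = - K e a b.
  have := KPm e (-1) a 0 b; rewrite addr0 scaleN1r => ->.
  have := KPm e (-1) 0 0 b; rewrite addr0 scaleN1r oppr0 => E.
  have : K e 0 b = 0 by lra.
  by move=> ->; rewrite addr0 mulN1r.
have KNr e a b : K e a (- b) = - K e a b by rewrite KC KN KC.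
have KJl e a b : K e (J a) b = - K e a (J b) by rewrite -KJ JK KN.
have KJr e a b : K e a (J b) = - K e b (J a) by rewrite KC KJl.
have gJr' a b : g a (J b) = - g b (J a) by rewrite gC gJl.
have := lck u v w; have := lck u (J v) (J w).
rewrite (gJl (Gam u v)) !GamE !KJl !gJl !JK !KNr !gN !opprK.
rewrite ?KJ ?gJ ?(KC _ w u) ?(gC w u) ?(KC _ w v) ?(gC w v) ?(KC _ v u) ?(gC v u).
rewrite ?(KJr _ w u) ?(KJr _ w v) ?(KJr _ v u) ?(gJr' w u) ?(gJr' w v) ?(gJr' v u).
lra.
Qed.

Lemma weyl_skew_algebra e f u v (a1 a2 b1 b2 : V) (H dth : R) :
  (forall e u v, K e u v = g (Gam e u) v + g u (Gam e v) + th e * g u v) ->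
  H = K e (Gam f u) v + g a1 v + (K e u (Gam f v) + g u b1)
      + (dth * g u v + th f * K e u v) ->
  H = K f (Gam e u) v + g a2 v + (K f u (Gam e v) + g u b2)
      + (dth * g u v + th e * K f u v) ->
  g (a1 - a2 + Gam e (Gam f u) - Gam f (Gam e u)) v =
  - g (b1 - b2 + Gam e (Gam f v) - Gam f (Gam e v)) u.
Proof.
move=> KE; rewrite !KE => E1 E2.
have gNl a b : g (- a) b = - g a b by exact: gNl.
rewrite !(gDl, gNl) (gC b1) (gC b2) (gC (Gam e (Gam f v))) (gC (Gam f (Gam e v))).
lra.
Qed.

End WeylAlgebra.

(** * Inner products, 1-forms and orthonormal bases in coordinates *)

Section InnerProducts.
Context {R : realType} {n : nat}.
Local Notation V := 'rV[R]_(n + n).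
Implicit Types (B E : 'M[R]_(n + n)) (a u v w : V).

Lemma J_is_linear : linear (@J R n).
Proof.
move=> c u v; apply/rowP => i; rewrite /J !mxE.
by case: splitP => j _; rewrite !mxE ?mulrN ?opprD.
Qed.

HB.instance Definition _ :=
  GRing.isLinear.Build R V V *:%R (@J R n) J_is_linear.

Lemma JJ u : J (J u) = - u.
Proof. by rewrite /J row_mxKl row_mxKr -opp_row_mx hsubmxK. Qed.

Lemma J_mulmx u : J u = u *m lin1_mx (@J R n).
Proof. by rewrite mul_rV_lin1. Qed.

Lemma innerDl B u v w : inner B (u + v) w = inner B u w + inner B v w.
Proof. by rewrite /inner !mulmxDl mxE. Qed.

Lemma innerZl B c u w : inner B (c *: u) w = c * inner B u w.
Proof. by rewrite /inner -!scalemxAl mxE. Qed.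

Lemma innerDr B u v w : inner B u (v + w) = inner B u v + inner B u w.
Proof. by rewrite /inner linearD mulmxDr mxE. Qed.

Lemma innerZr B c u w : inner B u (c *: w) = c * inner B u w.
Proof. by rewrite /inner linearZ -scalemxAr mxE. Qed.

Lemma innerNl B u w : inner B (- u) w = - inner B u w.
Proof. by rewrite -scaleN1r innerZl mulN1r. Qed.

Lemma innerP_mx B C c u w :
  inner (c *: B + C) u w = c * inner B u w + inner C u w.
Proof. by rewrite /inner mulmxDr mulmxDl -scalemxAr -scalemxAl !mxE. Qed.

Lemma inner_invmx B a w : B \in unitmx -> inner B (a *m invmx B) w = eval1 a w.
Proof.
move=> uB; rewrite /inner mulmxKV // /eval1.
transitivity ((a *m w^T)^T 0 0); first by rewrite [RHS]mxE.
by rewrite trmx_mul trmxK.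
Qed.

Lemma inner0l B w : inner B 0 w = 0.
Proof. by rewrite -(scale0r (0 : V)) innerZl mul0r. Qed.

Lemma inner0r B u : inner B u 0 = 0.
Proof. by rewrite -(scale0r (0 : V)) innerZr mul0r. Qed.

Lemma inner_mxP B : (forall u v, inner B u v = inner B v u) -> B^T = B.
Proof.
have entry i j : inner B (delta_mx 0 i) (delta_mx 0 j) = B i j.
  by rewrite /inner -rowE trmx_delta -colE !mxE.
by move=> BC; apply/matrixP => i j; rewrite mxE -!entry BC.
Qed.

Lemma eval1E a u : (u *m a^T) 0 0 = eval1 a u.
Proof. by []. Qed.

Lemma eval1D a u v : eval1 a (u + v) = eval1 a u + eval1 a v.
Proof. by rewrite /eval1 mulmxDl mxE. Qed.

Lemma eval1Z a c u : eval1 a (c *: u) = c * eval1 a u.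
Proof. by rewrite /eval1 -scalemxAl mxE. Qed.

Lemma eval1N a u : eval1 a (- u) = - eval1 a u.
Proof. by rewrite -scaleN1r eval1Z mulN1r. Qed.

Lemma eval10 a : eval1 a 0 = 0.
Proof. by rewrite -(scale0r (0 : V)) eval1Z mul0r. Qed.

Lemma row_functional (f : V -> R) w :
  (forall c u v, f (c *: u + v) = c * f u + f v) ->
  eval1 (\row_k f (delta_mx 0 k)) w = f w.
Proof.
move=> fL.
have f0 : f 0 = 0 by have := fL 1 0 0; rewrite scaler0 addr0; lra.
have fD u v : f (u + v) = f u + f v by have := fL 1 u v; rewrite scale1r mul1r.
rewrite [in RHS](row_sum_delta w) (big_morph f fD f0) /eval1 mxE.
apply: eq_bigr => k _; rewrite !mxE.
by rewrite -[_ *: _]addr0 fL f0 addr0.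
Qed.

Lemma linear_matrix (f : V -> V) w :
  (forall c u v, f (c *: u + v) = c *: f u + f v) ->
  f w = w *m \matrix_k f (delta_mx 0 k).
Proof.
move=> fL.
have fD u v : f (u + v) = f u + f v by have := fL 1 u v; rewrite !scale1r.
have f0 : f 0 = 0 by have := fL (-1) 0 0; rewrite scaler0 addr0 scaleN1r addNr.
rewrite [in LHS](row_sum_delta w) (big_morph f fD f0) mulmx_sum_row.
by apply: eq_bigr => k _; rewrite rowK -[_ *: _]addr0 fL f0 addr0.
Qed.

Section PositiveDefinite.
Variable B : 'M[R]_(n + n).
Hypothesis BC : forall u v, inner B u v = inner B v u.
Hypothesis Bpos : forall u, u != 0 -> 0 < inner B u u.

Let E := orthonormal_basis B.

(** Since a basis exists by [posdef_orthonormal], [xget] does not return its default 0. *)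
Lemma orthonormal_basisP : E *m B *m E^T = 1%:M.
Proof.
have [E0 E0P] := posdef_orthonormal (inner_mxP BC) Bpos.
have entry (F : 'M[R]_(n + n)) i j :
    inner B (row i F) (row j F) = (F *m B *m F^T) i j.
  by rewrite /inner tr_row -!row_mul !mxE; apply: eq_bigr => k _; rewrite !mxE.
have : exists F : 'M[R]_(n + n),
    forall i j, inner B (row i F) (row j F) = (i == j)%:R.
  by exists E0 => i j; rewrite entry E0P mxE.
move=> /(xgetPex 0) EP.
by apply/matrixP => i j; rewrite -entry EP mxE.
Qed.

Lemma posdef_unitmx : B \in unitmx.
Proof.
have := orthonormal_basisP; rewrite -mulmxA => /mulmx1C; rewrite -mulmxA.
by case/mulmx1_unit.
Qed.

(** The basis itself is arbitrary, but this product is not; through it the trace and Parseval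
    identities below become independent of the choice. *)
Lemma orthonormal_basis_gram : E^T *m E = invmx B.
Proof.
have := orthonormal_basisP; rewrite -mulmxA => /mulmx1C; rewrite -mulmxA => BE.
by rewrite -[LHS]mul1mx -(mulVmx posdef_unitmx) -mulmxA BE mulmx1.
Qed.

Lemma orthonormal_basis_trace (M : 'M[R]_(n + n)) :
  \sum_i inner B (row i E *m M) (row i E) = \tr M.
Proof.
transitivity (\tr (E *m M *m B *m E^T)).
  apply: eq_bigr => i _; rewrite /inner tr_row -!row_mul !mxE.
  by apply: eq_bigr => k _; rewrite !mxE.
rewrite -mulmxA mxtrace_mulC mulmxA -(mulmxA B) orthonormal_basis_gram.
by rewrite mulmxV ?mul1mx // posdef_unitmx.
Qed.

Lemma orthonormal_basis_parseval u v :
  \sum_i inner B (row i E) u * inner B (row i E) v = inner B u v.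
Proof.
have -> : inner B u v = (u *m B *m E^T *m (E *m B *m v^T)) 0 0.
  rewrite !mulmxA -(mulmxA _ E^T) orthonormal_basis_gram -(mulmxA u).
  by rewrite mulmxV ?mulmx1 // posdef_unitmx.
rewrite mxE; apply: eq_bigr => i _; rewrite (BC _ u); congr (_ * _).
  by rewrite /inner tr_row !mxE; apply: eq_bigr => k _; rewrite !mxE.
by rewrite /inner -!row_mul mxE.
Qed.

Lemma orthonormal_basis_dim : \sum_i inner B (row i E) (row i E) = (n + n)%:R.
Proof.
rewrite -(@mxtrace1 R) -orthonormal_basis_trace.
by apply: eq_bigr => i _; rewrite mulmx1.
Qed.

Lemma inner_inj u v : (forall w, inner B u w = inner B v w) -> u = v.
Proof.
move=> uv; apply/eqP; rewrite -subr_eq0; apply/negPn/negP => /Bpos.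
by rewrite innerDl innerNl uv subrr ltxx.
Qed.

End PositiveDefinite.

End InnerProducts.

(** * Product rules for coordinate expressions *)

Section DerivativeRules.
Context {R : realType} {n : nat} {W : normedModType R}.
Local Notation V := 'rV[R]_(n + n).
Implicit Types (x v : W).

Lemma is_derive_entry p q (A : W -> 'M[R]_(p, q)) x v dA i j :
  is_derive x v A dA -> is_derive x v (fun y => A y i j) (dA i j).
Proof.
move=> [cA <-]; rewrite derive_entry //; apply: derivableP.
by move/derivable_mxP : cA; apply.
Qed.

Lemma is_derive_tr p q (A : W -> 'M[R]_(p, q)) x v dA :
  is_derive x v A dA -> is_derive x v (fun y => (A y)^T) dA^T.
Proof.
move=> hA.
have ent i j : is_derive x v (fun y => (A y)^T i j) (dA^T i j).
  have -> : (fun y => (A y)^T i j) = (fun y => A y j i).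
    by apply/funext => y; rewrite mxE.
  by rewrite mxE; exact: is_derive_entry.
have cAt : derivable (fun y => (A y)^T) x v.
  by apply/derivable_mxP => i j; case: (ent i j).
split=> //; apply/matrixP => i j.
by rewrite derive_entry //; case: (ent i j).
Qed.

Lemma is_derive_inner (G : W -> 'M[R]_(n + n)) (a b : W -> V) x v dG da db :
  is_derive x v G dG -> is_derive x v a da -> is_derive x v b db ->
  is_derive x v (fun y => inner (G y) (a y) (b y))
    (inner dG (a x) (b x) + inner (G x) da (b x) + inner (G x) (a x) db).
Proof.
move=> hG ha hb.
have := is_derive_entry 0 0
  (is_derive_mulmx (is_derive_mulmx ha hG) (is_derive_tr hb)).
move=> /is_derive_eq; apply.
by rewrite mxE mulmxDl [X in X + _]mxE; congr (_ + _); exact: addrC.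
Qed.

Lemma is_derive_eval1 (th a : W -> V) x v dth da :
  is_derive x v th dth -> is_derive x v a da ->
  is_derive x v (fun y => eval1 (th y) (a y))
    (eval1 dth (a x) + eval1 (th x) da).
Proof.
move=> hth ha.
have := is_derive_entry 0 0 (is_derive_mulmx ha (is_derive_tr hth)).
by move=> /is_derive_eq; apply; rewrite mxE addrC.
Qed.

Lemma is_derive_inner_constr (G : W -> 'M[R]_(n + n)) (a : W -> V) (w : V)
    x v dG da : is_derive x v G dG -> is_derive x v a da ->
  is_derive x v (fun y => inner (G y) (a y) w)
    (inner dG (a x) w + inner (G x) da w).
Proof.
move=> hG ha; apply: is_derive_eq (is_derive_inner hG ha (is_derive_cst w x v)) _.
by rewrite inner0r addr0.
Qed.

Lemma is_derive_inner_constl (G : W -> 'M[R]_(n + n)) (u : V) (b : W -> V)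
    x v dG db : is_derive x v G dG -> is_derive x v b db ->
  is_derive x v (fun y => inner (G y) u (b y))
    (inner dG u (b x) + inner (G x) u db).
Proof.
move=> hG hb; apply: is_derive_eq (is_derive_inner hG (is_derive_cst u x v) hb) _.
by rewrite inner0l addr0.
Qed.

Lemma is_derive_inner_const (G : W -> 'M[R]_(n + n)) (u w : V) x v dG :
  is_derive x v G dG -> is_derive x v (fun y => inner (G y) u w) (inner dG u w).
Proof.
move=> hG; apply: is_derive_eq (is_derive_inner_constl u hG (is_derive_cst w x v)) _.
by rewrite inner0r addr0.
Qed.

Lemma is_derive_eval1_const (th : W -> V) (u : V) x v dth :
  is_derive x v th dth -> is_derive x v (fun y => eval1 (th y) u) (eval1 dth u).
Proof.
move=> hth; apply: is_derive_eq (is_derive_eval1 hth (is_derive_cst u x v)) _.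
by rewrite eval10 addr0.
Qed.

Lemma is_derive_J (a : W -> V) x v da :
  is_derive x v a da -> is_derive x v (fun y => J (a y)) (J da).
Proof.
move=> ha.
have := is_derive_mulmx ha (is_derive_cst (lin1_mx (@J R n)) x v).
rewrite mulmx0 addr0 -J_mulmx.
have -> // : (fun y => a y *m cst (lin1_mx (@J R n)) y) = (fun y => J (a y)).
by apply/funext => y; rewrite J_mulmx.
Qed.

Lemma Ck_inner k (U : set W) (G : W -> 'M[R]_(n + n)) (u w : V) : open U ->
  Ckmx k U G -> Ck k U (fun x => inner (G x) u w).
Proof.
move=> oU Gk.
exact: (Ckmx_mul oU (Ckmx_mul oU (Ckmx_cst _ _ u) Gk) (Ckmx_cst _ _ w^T)).
Qed.

Lemma Ck_eval1 k (U : set W) (a : W -> V) (u : V) : open U ->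
  Ckmx k U a -> Ck k U (fun x => eval1 (a x) u).
Proof.
move=> oU ak.
apply: (Ckmx_mul oU (Ckmx_cst _ _ u) (B := fun x => (a x)^T)) => i j.
by apply: eq_Ck (ak j i) => // x _; rewrite mxE.
Qed.

Lemma is_derive_scale (c : W -> R) (a : W -> V) x v dc da :
  is_derive x v c dc -> is_derive x v a da ->
  is_derive x v (fun y => c y *: a y) (dc *: a x + c x *: da).
Proof.
move=> hc ha.
have ent i j : is_derive x v (fun y => (c y *: a y) i j)
    ((dc *: a x + c x *: da) i j).
  have -> : (fun y => (c y *: a y) i j) = c * (fun y => a y i j).
    by apply/funext => y; rewrite mxE.
  apply: is_derive_eq (is_deriveM hc (is_derive_entry i j ha)) _.
  by rewrite !mxE addrC; congr (_ + _); exact: mulrC.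
have cca : derivable (fun y => c y *: a y) x v.
  by apply/derivable_mxP => i j; case: (ent i j).
split=> //; apply/matrixP => i j.
by rewrite derive_entry //; case: (ent i j).
Qed.

End DerivativeRules.

(** * The Weyl connection *)

(* Without this, failed unifications unfold inner products and limits. *)
Opaque inner eval1 derive.

Section WeylConnection.
Context {R : realType} {n : nat}.
Local Notation V := 'rV[R]_(n + n).
Variables (G : V -> 'M[R]_(n + n)) (theta : V -> V).
Implicit Types (x y e f u v w : V).

Definition derive_metric x e u v : R := inner ('D_e G x) u v.

(** Where theta = df, these are the Christoffel symbols of the metric exp(-f) g: the bracket is the
    usual conformal change of the Levi-Civita connection. *)
Definition weyl x u v : V :=
  christoffel G x u v - 2^-1 *: (eval1 (theta x) u *: v + eval1 (theta x) v *: u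
    - inner (G x) u v *: sharp G theta x).

Definition weyl_curvature x e f u : V :=
  'D_e (fun y => weyl y f u) x - 'D_f (fun y => weyl y e u) x
  + weyl x e (weyl x f u) - weyl x f (weyl x e u).

Record hermitian_on (U : set V) : Prop := {
  herm_open : open U;
  herm_smooth : smooth_on U G;
  herm_form_smooth : smooth_on U theta;
  herm_sym : forall x u v, U x -> inner (G x) u v = inner (G x) v u;
  herm_pos : forall x u, U x -> u != 0 -> 0 < inner (G x) u u;
  herm_J : forall x u v, U x -> inner (G x) (J u) (J v) = inner (G x) u v }.

Variable U : set V.
Hypothesis hermU : hermitian_on U.

Let oU : open U := herm_open hermU.
Let G_sym x u v : U x -> inner (G x) u v = inner (G x) v u :=
  @herm_sym U hermU x u v.
Let G_pos x u : U x -> u != 0 -> 0 < inner (G x) u u := @herm_pos U hermU x u.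
Let G_J x u v : U x -> inner (G x) (J u) (J v) = inner (G x) u v :=
  @herm_J U hermU x u v.
Lemma metric_Ckmx k : Ckmx k U G.
Proof. exact: (smooth_Ckmx k oU (herm_smooth hermU)). Qed.

Lemma form_Ckmx k : Ckmx k U theta.
Proof. exact: (smooth_Ckmx k oU (herm_form_smooth hermU)). Qed.

Lemma near_U x (P : V -> Prop) : U x -> (forall y, U y -> P y) -> \near x, P x.
Proof. by move=> Ux UP; apply: filterS (open_nbhs_nbhs (conj oU Ux)). Qed.

Lemma metric_unitmx x : U x -> G x \in unitmx.
Proof. by move=> Ux; apply: posdef_unitmx => [u v|u]; [exact: G_sym|exact: G_pos]. Qed.

Lemma metric_inj x u v : U x ->
  (forall w, inner (G x) u w = inner (G x) v w) -> u = v.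
Proof. by move=> Ux; apply: inner_inj => w; exact: G_pos. Qed.

Lemma metric_Jl x u v : U x -> inner (G x) (J u) v = - inner (G x) u (J v).
Proof. by move=> Ux; rewrite -G_J // JJ innerNl. Qed.

Lemma inverse_metric_Ckmx k : Ckmx k U (fun x => invmx (G x)).
Proof.
by apply: Ckmx_inv => // [x|]; [exact: metric_unitmx|exact: metric_Ckmx].
Qed.

Lemma inner_Ck k u v : Ck k U (fun x => inner (G x) u v).
Proof. by apply: Ck_inner => //; exact: metric_Ckmx. Qed.

Lemma eval1_Ck k u : Ck k U (fun x => eval1 (theta x) u).
Proof. by apply: Ck_eval1 => //; exact: form_Ckmx. Qed.

Lemma sharp_Ckmx k : Ckmx k U (sharp G theta).
Proof. exact: (Ckmx_mul oU (form_Ckmx k) (inverse_metric_Ckmx k)). Qed.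

Lemma inner_sharp x u : U x -> inner (G x) (sharp G theta x) u = eval1 (theta x) u.
Proof.
by move=> Ux; rewrite inner_invmx ?metric_unitmx.
Qed.

Lemma derive_inner x e u v : U x ->
  'D_e (fun y => inner (G y) u v) x = inner ('D_e G x) u v.
Proof.
move=> Ux.
by have [] := is_derive_inner_const u v (Ckmx_is_derive e (metric_Ckmx 0) Ux).
Qed.

Lemma derive_eval1 x e u : U x ->
  'D_e (fun y => eval1 (theta y) u) x = eval1 ('D_e theta x) u.
Proof.
move=> Ux.
by have [] := is_derive_eval1_const u (Ckmx_is_derive e (form_Ckmx 0) Ux).
Qed.

Lemma derive_metricC x e u v : U x ->
  derive_metric x e u v = derive_metric x e v u.
Proof.
move=> Ux; rewrite /derive_metric -!derive_inner //; apply: near_eq_derive.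
by apply: near_U => // y Uy; exact: G_sym.
Qed.

Lemma derive_metricJ x e u v : U x ->
  derive_metric x e (J u) (J v) = derive_metric x e u v.
Proof.
move=> Ux; rewrite /derive_metric -!derive_inner //; apply: near_eq_derive.
by apply: near_U => // y Uy; exact: G_J.
Qed.

Lemma derive_metricPl x c u v a b : U x ->
  derive_metric x (c *: u + v) a b =
  c * derive_metric x u a b + derive_metric x v a b.
Proof.
by move=> Ux; rewrite /derive_metric (Ckmx_derive_linear _ _ _ (metric_Ckmx 0) Ux) innerP_mx.
Qed.

Lemma derive_metricPm x e c u v w : U x ->
  derive_metric x e (c *: u + v) w =
  c * derive_metric x e u w + derive_metric x e v w.
Proof. by move=> Ux; rewrite /derive_metric innerDl innerZl. Qed.

Lemma eval1P a c u v : eval1 a (c *: u + v) = c * eval1 a u + eval1 a v.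
Proof. by rewrite eval1D eval1Z. Qed.

(** [christoffel] tests the Koszul form on coordinate vectors only; linearity in w extends the
    formula to all w. *)
Lemma inner_christoffel x u v w : U x ->
  inner (G x) (christoffel G x u v) w =
  2^-1 * (inner ('D_u G x) v w + inner ('D_v G x) u w - inner ('D_w G x) u v).
Proof.
move=> Ux; rewrite inner_invmx ?metric_unitmx //.
pose F w : R := 2^-1 *
  (inner ('D_u G x) v w + inner ('D_v G x) u w - inner ('D_w G x) u v).
rewrite -[RHS]/(F w) -[RHS]row_functional; last first.
  move=> c a b; apply: (@koszul_form_linear _ _ (derive_metric x)
    _ _ _ u v c a b F).
  - by move=> *; exact: derive_metricPl.
  - by move=> *; exact: derive_metricPm.
  - by move=> *; exact: derive_metricC.
  - by [].
by congr eval1; apply/rowP => k; rewrite !mxE /F !derive_inner.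
Qed.

(** The correction terms of [weyl] amount to replacing each derivative of g in the Koszul formula by
    the derivative minus theta (x) g. *)
Lemma inner_weyl x u v w : U x ->
  inner (G x) (weyl x u v) w =
  2^-1 * ((derive_metric x u v w - eval1 (theta x) u * inner (G x) v w)
        + (derive_metric x v u w - eval1 (theta x) v * inner (G x) u w)
        - (derive_metric x w u v - eval1 (theta x) w * inner (G x) u v)).
Proof.
move=> Ux; rewrite /weyl innerDl innerNl innerZl !(innerDl, innerNl, innerZl).
rewrite inner_christoffel // inner_sharp // /derive_metric.
generalize (inner ('D_u G x) v w) (inner ('D_v G x) u w) (inner ('D_w G x) u v).
generalize (inner (G x) u v) (inner (G x) u w) (inner (G x) v w).
generalize (eval1 (theta x) u) (eval1 (theta x) v) (eval1 (theta x) w).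
by move=> *; ring.
Qed.

Lemma weyl_sym x u v : U x -> weyl x u v = weyl x v u.
Proof.
move=> Ux; apply: (koszul_sym (g := inner (G x)) (th := eval1 (theta x))
  (K := derive_metric x)).
- by move=> a b; exact: G_sym.
- by move=> a b; exact: metric_inj.
- by move=> *; exact: derive_metricC.
- by move=> *; exact: inner_weyl.
Qed.

Lemma weylP x c u v w : U x -> weyl x u (c *: v + w) = c *: weyl x u v + weyl x u w.
Proof.
move=> Ux; apply: (koszul_linear (g := inner (G x)) (th := eval1 (theta x))
  (K := derive_metric x)).
- by move=> a b; exact: G_sym.
- by move=> *; exact: innerDl.
- by move=> *; exact: innerZl.
- by move=> a b; exact: metric_inj.
- by move=> *; exact: eval1P.
- by move=> *; exact: derive_metricPl.
- by move=> *; exact: derive_metricPm.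
- by move=> *; exact: derive_metricC.
- by move=> *; exact: inner_weyl.
Qed.

Lemma weylD x u v w : U x -> weyl x u (v + w) = weyl x u v + weyl x u w.
Proof. by move=> Ux; have := weylP 1 u v w Ux; rewrite !scale1r. Qed.

Lemma weyl0 x u : U x -> weyl x u 0 = 0.
Proof. by move=> Ux; have := weylP (-1) u 0 0 Ux; rewrite scaler0 addr0 scaleN1r addNr. Qed.

Lemma weylZ x c u v : U x -> weyl x u (c *: v) = c *: weyl x u v.
Proof. by move=> Ux; have := weylP c u v 0 Ux; rewrite weyl0 // !addr0. Qed.

Lemma weyl_metric x e u v : U x ->
  derive_metric x e u v = inner (G x) (weyl x e u) v + inner (G x) u (weyl x e v)
    + eval1 (theta x) e * inner (G x) u v.
Proof.
move=> Ux; apply: (koszul_metric (g := inner (G x)) (th := eval1 (theta x))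
  (K := derive_metric x)).
- by move=> a b; exact: G_sym.
- by move=> *; exact: derive_metricC.
- by move=> *; exact: inner_weyl.
Qed.

Lemma weyl_Ckmx k u v : Ckmx k U (fun x => weyl x u v).
Proof.
have innerD2 a b c : Ck k U (fun x => 'D_a (fun y => inner (G y) b c) x).
  exact: (Ck_derive _ (inner_Ck k.+1 b c)).
apply: CkmxB => //.
  apply: Ckmx_mul => //; last exact: inverse_metric_Ckmx.
  move=> i j; apply: (@eq_Ck _ _ _ _ (fun x => 2^-1 *
    ('D_u (fun y => inner (G y) v (delta_mx 0 j)) x
     + 'D_v (fun y => inner (G y) u (delta_mx 0 j)) x
     - 'D_(delta_mx 0 j) (fun y => inner (G y) u v) x))) => //.
    by move=> x _; rewrite mxE.
  apply: CkM => //; first exact: Ck_cst.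
  by apply: CkB => //; apply: CkD.
apply: CkmxZ => //; first exact: Ck_cst.
apply: CkmxB => //; first apply: CkmxD => //.
- by apply: CkmxZ => //; [exact: eval1_Ck|exact: Ckmx_cst].
- by apply: CkmxZ => //; [exact: eval1_Ck|exact: Ckmx_cst].
- by apply: CkmxZ => //; [exact: inner_Ck|exact: sharp_Ckmx].
Qed.

Lemma weyl_curvature_skew x e f u : weyl_curvature x e f u = - weyl_curvature x f e u.
Proof. exact: sub_add_sub_opp. Qed.

Lemma weyl_bianchi x e f u : U x ->
  weyl_curvature x e f u + weyl_curvature x f u e + weyl_curvature x u e f = 0.
Proof.
move=> Ux; have DC a b c : 'D_a (fun y => weyl y b c) x = 'D_a (fun y => weyl y c b) x.
  by apply: near_eq_derive; apply: near_U => // y Uy; exact: weyl_sym.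
rewrite /weyl_curvature (DC e u f) (DC f u e) (DC u f e).
rewrite (weyl_sym u f Ux) (weyl_sym u e Ux) (weyl_sym f e Ux).
exact: sub_add_sub_cyclic.
Qed.

End WeylConnection.

(** * Consequences of the Vaisman conditions in one chart *)

Section LocalVaisman.
Context {R : realType} {n : nat}.
Local Notation V := 'rV[R]_(n + n).
Variables (G : V -> 'M[R]_(n + n)) (theta : V -> V).
Implicit Types (x y e f u v w : V).

Record vaisman_on (U : set V) : Prop := {
  vaisman_herm : hermitian_on G theta U;
  vaisman_lck : forall x u v w, U x ->
    d2 (fundamental G) x u v w = wedge12 theta (fundamental G) x u v w;
  vaisman_nabla : forall x u v, U x -> nabla_theta G theta x u v = 0 }.

Variable U : set V.
Hypothesis vaismanU : vaisman_on U.

Let hermU : hermitian_on G theta U := vaisman_herm vaismanU.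
Let T := sharp G theta.
Let Gam := weyl G theta.
Let oU : open U := herm_open hermU.

Lemma weyl_J x u v : U x -> weyl G theta x u (J v) = J (weyl G theta x u v).
Proof.
move=> Ux; apply: (koszul_J (g := inner (G x)) (th := eval1 (theta x))
  (K := derive_metric G x)).
- by move=> a b; exact: (herm_sym hermU).
- by move=> *; exact: innerZl.
- exact: JJ.
- by move=> *; exact: (herm_J hermU).
- by move=> a b; exact: (metric_inj hermU).
- by move=> *; exact: derive_metricPm.
- by move=> *; exact: (derive_metricC hermU).
- by move=> *; exact: (derive_metricJ hermU).
- by move=> *; exact: (inner_weyl hermU).
(* As J is constant in the chart, d omega on constant fields contains only derivatives of g, and the
   lcK equation becomes the hypothesis of [koszul_J]. *)
move=> a b c; have := vaisman_lck vaismanU a b c Ux; rewrite /d2 /fundamental.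
by rewrite !(derive_inner hermU).
Qed.

Lemma eval1_weyl x u v : U x -> eval1 (theta x) (weyl G theta x u v) =
  eval1 (theta x) (christoffel G x u v)
  - 2^-1 * (2 * (eval1 (theta x) u * eval1 (theta x) v)
            - inner (G x) u v * inner (G x) (T x) (T x)).
Proof.
move=> Ux; rewrite /weyl eval1D eval1N eval1Z eval1D eval1N eval1D !eval1Z.
rewrite -(inner_sharp hermU (sharp G theta x) Ux) -/T.
by congr (_ - _ * (_ - _)); rewrite mulrC mulr_natl mulr2n.
Qed.

(** The condition nabla^g theta = 0 says that the derivative of theta is theta applied to the
    Levi-Civita symbols; rewriting these through Gam produces the quadratic terms in theta. *)
Lemma derive_form x e u : U x ->
  eval1 ('D_e theta x) u = dtheta (inner (G x)) (T x) (Gam x) e u.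
Proof.
move=> Ux; have := vaisman_nabla vaismanU e u Ux.
rewrite /nabla_theta /levi_civita derive_cst add0r (derive_eval1 hermU) //.
move=> /eqP; rewrite subr_eq0 => /eqP ->.
rewrite /dtheta /T !(inner_sharp hermU) // /Gam eval1_weyl // -/T.
rewrite -(inner_sharp hermU (T x) Ux) -/T /cst.
generalize (eval1 (theta x) (christoffel G x e u)).
generalize (eval1 (theta x) e) (eval1 (theta x) u) (inner (G x) e u).
by generalize (inner (G x) (T x) (T x)) => *; field.
Qed.

Lemma derive_metricE x e u v : U x ->
  derive_metric G x e u v = dg (inner (G x)) (T x) (Gam x) e u v.
Proof.
by move=> Ux; rewrite (weyl_metric hermU) // /dg /T (inner_sharp hermU).
Qed.

(** Differentiating g(theta#, w) = theta(w) leaves the derivative of theta# as the only unknown, and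
    g is nondegenerate. *)
Lemma derive_sharp x e : U x ->
  'D_e T x = dsharp (inner (G x)) (T x) (Gam x) e.
Proof.
move=> Ux; apply: (metric_inj hermU Ux) => w.
have Tx : is_derive x e T ('D_e T x).
  exact: (Ckmx_is_derive e (sharp_Ckmx hermU 0) Ux).
have [_ E] := is_derive_inner_constr w
  (Ckmx_is_derive e (metric_Ckmx hermU 0) Ux) Tx.
have {}E : derive_metric G x e (T x) w + inner (G x) ('D_e T x) w =
    eval1 ('D_e theta x) w.
  rewrite -(derive_eval1 hermU) //; move: E => <-.
  apply: near_eq_derive; apply: (near_U hermU Ux) => y Uy.
  exact: (inner_sharp hermU).
move: E; rewrite derive_metricE // derive_form // /dg /dtheta /dsharp.
have combo a c : inner (G x) (- a - c *: e) w = - inner (G x) a w - c * inner (G x) e w.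
  by rewrite innerDl !innerNl innerZl.
rewrite combo => /(canRL (addKr _)) ->.
generalize (inner (G x) (Gam x e (T x)) w) (inner (G x) (T x) (Gam x e w)).
generalize (inner (G x) (T x) e) (inner (G x) (T x) w) (inner (G x) e w).
generalize (inner (G x) (T x) (T x)).
by move=> *; field.
Qed.

Lemma derive_form_sym x e u : U x ->
  eval1 ('D_e theta x) u = eval1 ('D_u theta x) e.
Proof.
move=> Ux; rewrite !derive_form // /dtheta /Gam (weyl_sym hermU u e) //.
by rewrite (herm_sym hermU u e) // (mulrC (inner _ _ u)).
Qed.

(** Differentiating D g = theta (x) g once more and exchanging the two directions leaves only d
    theta (x) g, which is zero by [derive_form_sym]. *)
Lemma weyl_curvature_skewr x e f u v : U x ->
  inner (G x) (weyl_curvature G theta x e f u) v =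
  - inner (G x) (weyl_curvature G theta x e f v) u.
Proof.
move=> Ux.
have second e' f' : inner ('D_e' (fun y => 'D_f' G y) x) u v =
    derive_metric G x e' (Gam x f' u) v
    + inner (G x) ('D_e' (fun y => Gam y f' u) x) v
    + (derive_metric G x e' u (Gam x f' v)
       + inner (G x) u ('D_e' (fun y => Gam y f' v) x))
    + (eval1 ('D_e' theta x) f' * inner (G x) u v
       + eval1 (theta x) f' * derive_metric G x e' u v).
  have DG := Ckmx_is_derive e' (metric_Ckmx hermU 0) Ux.
  have DW w := Ckmx_is_derive e' (weyl_Ckmx hermU 0 f' w) Ux.
  have Dth := is_derive_eval1_const f' (Ckmx_is_derive e' (form_Ckmx hermU 0) Ux).
  have [_ D] := is_deriveD (is_deriveD (is_derive_inner_constr v DG (DW u))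
    (is_derive_inner_constl u DG (DW v)))
    (is_deriveM Dth (is_derive_inner_const u v DG)).
  have [_ <-] := is_derive_inner_const u v
    (Ckmx_is_derive e' (Ckmx_derive f' oU (metric_Ckmx hermU 1)) Ux).
  rewrite [X in _ = _ + X]addrC (mulrC (eval1 ('D_e' theta x) f')).
  apply: etrans D; apply: near_eq_derive; apply: (near_U hermU Ux) => y Uy.
  exact: (weyl_metric hermU).
apply: (@weyl_skew_algebra _ _ (inner (G x)) (eval1 (theta x))
  (derive_metric G x) (weyl G theta x) _ _ _ e f u v _ _ _ _
  (inner ('D_e (fun y => 'D_f G y) x) u v) (eval1 ('D_e theta x) f)).
- by move=> a b; exact: (herm_sym hermU).
- by move=> *; exact: innerDl.
- by move=> *; exact: innerZl.
- by move=> *; exact: (weyl_metric hermU).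
- exact: second.
- rewrite (Ckmx_derive_comm e f oU (metric_Ckmx hermU 2) Ux).
  by rewrite (derive_form_sym e f Ux); exact: second.
Qed.

Lemma weyl_curvature_linear x e f c u v : U x ->
  weyl_curvature G theta x e f (c *: u + v) =
  c *: weyl_curvature G theta x e f u + weyl_curvature G theta x e f v.
Proof.
move=> Ux.
have DP a b : 'D_a (fun y => weyl G theta y b (c *: u + v)) x =
    c *: 'D_a (fun y => weyl G theta y b u) x + 'D_a (fun y => weyl G theta y b v) x.
  have Du w := Ckmx_is_derive a (weyl_Ckmx hermU 0 b w) Ux.
  have [_ <-] := is_deriveD (is_deriveZ c (Du u)) (Du v).
  by apply: near_eq_derive; apply: (near_U hermU Ux) => y; exact: (weylP hermU).
have PB (a b p q a' b' p' q' : V) : (c *: a + a') - (c *: b + b')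
    + (c *: p + p') - (c *: q + q') = c *: (a - b + p - q) + (a' - b' + p' - q').
  by apply/rowP => i; rewrite !mxE; ring.
rewrite /weyl_curvature (DP e f) (DP f e).
rewrite (weylP hermU c f u v Ux) (weylP hermU c e u v Ux).
rewrite (weylP hermU c e (weyl G theta x f u) (weyl G theta x f v) Ux).
rewrite (weylP hermU c f (weyl G theta x e u) (weyl G theta x e v) Ux).
exact: PB.
Qed.

End LocalVaisman.

(** * The Gauduchon connections and the second Ricci form *)

Section GauduchonCurvature.
Context {R : realType} {n : nat}.
Local Notation V := 'rV[R]_(n + n).
Variables (G : V -> 'M[R]_(n + n)) (theta : V -> V) (U : set V) (t : R).
Implicit Types (x y e f u v w : V).
Hypothesis vaismanU : vaisman_on G theta U.

Let hermU : hermitian_on G theta U := vaisman_herm vaismanU.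
Let T := sharp G theta.
Let A x e u := gauduchon_part (@J R n) (inner (G x)) t (T x) e u.
Let Gam := weyl G theta.

(** The terms theta(Y) X and g(X, Y) theta# have coefficients -(t + 1) / 4 and (t + 1) / 4 relative
    to the Levi-Civita connection. Relative to D they become s and -s, matching the J-terms, so that
    the four assemble into s times [lee_part]. *)
Lemma gauduchon_weyl (X Y : V -> V) x : U x ->
  gauduchon t G theta X Y x =
  'D_(X x) Y x + (Gam x (X x) (Y x) + A x (X x) (Y x)).
Proof.
move=> Ux; rewrite /gauduchon /levi_civita /Gam /weyl /A.
rewrite /gauduchon_part /lee_part /fundamental /T !(inner_sharp hermU) //=.
generalize ('D_(X x) Y x) (christoffel G x (X x) (Y x)) (sharp G theta x) => D C S.
generalize (eval1 (theta x) (X x)) (eval1 (theta x) (Y x)) => a1 a2.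
generalize (eval1 (theta x) (J (X x))) (eval1 (theta x) (J (Y x))) => a3 a4.
generalize (inner (G x) (X x) (Y x)) (inner (G x) (J (X x)) (Y x)) => b1 b2.
generalize (J (X x)) (J (Y x)) (J S) => JX JY JS.
generalize (X x) (Y x) => Xx Yx.
by apply/rowP => i; rewrite !mxE; field.
Qed.

Lemma gauduchon_partP x e c u v :
  A x e (c *: u + v) = c *: A x e u + A x e v.
Proof.
have JP : J (c *: u + v) = c *: J u + J v by exact: linearP.
rewrite /A /gauduchon_part /lee_part /= JP !innerDr !innerZr.
generalize (J u) (J v) (J e) (J (T x)) (T x) => Ju Jv Je JT Tx.
generalize (inner (G x) Tx e) (inner (G x) Tx Je) => a1 a2.
generalize (inner (G x) Tx u) (inner (G x) Tx Ju) => a3 a4.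
generalize (inner (G x) Tx v) (inner (G x) Tx Jv) => a5 a6.
generalize (inner (G x) e u) (inner (G x) Je u) => a7 a8.
generalize (inner (G x) e v) (inner (G x) Je v) => a9 a10.
by apply/rowP => i; rewrite !mxE; ring.
Qed.

Lemma is_derive_gauduchon_part x e f u : U x ->
  is_derive x e (fun y => A y f u)
    (d_gauduchon_part (@J R n) (inner (G x)) t (T x) (Gam x) e f u).
Proof.
move=> Ux.
have DT : is_derive x e T (dsharp (inner (G x)) (T x) (Gam x) e).
  rewrite -(derive_sharp vaismanU) //.
  exact: (Ckmx_is_derive e (sharp_Ckmx hermU 0) Ux).
have Dth w : is_derive x e (fun y => inner (G y) (T y) w)
    (dtheta (inner (G x)) (T x) (Gam x) e w).
  rewrite -(derive_form vaismanU) //.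
  apply: near_eq_is_derive (is_derive_eval1_const w
    (Ckmx_is_derive e (form_Ckmx hermU 0) Ux)).
  by apply: (near_U hermU Ux) => y Uy; rewrite (inner_sharp hermU).
have Dg w z : is_derive x e (fun y => inner (G y) w z)
    (dg (inner (G x)) (T x) (Gam x) e w z).
  rewrite -(derive_metricE vaismanU) //.
  exact: is_derive_inner_const (Ckmx_is_derive e (metric_Ckmx hermU 0) Ux).
have Dc w := is_derive_cst w x e.
have D1 := is_derive_scale (is_deriveM (Dth f) (is_derive_cst (2^-1 : R) x e)) (Dc u).
have D2 := is_derive_scale (is_deriveM (is_derive_cst (t / 2) x e) (Dth (J f))) (Dc (J u)).
have L1 := is_derive_scale (Dth u) (Dc f).
have L2 := is_derive_scale (Dg f u) DT.
have L3 := is_derive_scale (Dth (J u)) (Dc (J f)).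
have L4 := is_derive_scale (Dg (J f) u) (is_derive_J DT).
have D := is_deriveD (is_deriveB D1 D2)
  (is_deriveZ ((1 - t) / 4) (is_deriveB (is_deriveB (is_deriveB L1 L2) L3) L4)).
apply: is_derive_eq D _.
rewrite /d_gauduchon_part /d_lee_part /=.
generalize (dtheta (inner (G x)) (T x) (Gam x)) => dth.
generalize (dg (inner (G x)) (T x) (Gam x)) => dgx.
generalize (dsharp (inner (G x)) (T x) (Gam x) e) => dT.
generalize (inner (G x)) => I.
generalize (T x) => Tx.
rewrite /cst !scaler0 !addr0 ?add0r.
congr (_ *: _ - _ *: _ + _).
  exact: mulrC.
Qed.

Lemma gauduchon_curvature x e f u : U x ->
  curvature (gauduchon t G theta) (cst e) (cst f) (cst u) x =
  weyl_curvature G theta x e f u +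
  (curvature_part (@J R n) (inner (G x)) t (T x) (Gam x) e f u
   - curvature_part (@J R n) (inner (G x)) t (T x) (Gam x) f e u).
Proof.
move=> Ux.
have nabla_const a b y : U y ->
    gauduchon t G theta (cst a) (cst b) y = Gam y a b + A y a b.
  by move=> Uy; rewrite gauduchon_weyl // derive_cst add0r.
have nabla2 a b : gauduchon t G theta (cst a) (gauduchon t G theta (cst b) (cst u)) x =
    'D_a (fun y => Gam y b u) x + Gam x a (Gam x b u)
    + curvature_part (@J R n) (inner (G x)) t (T x) (Gam x) a b u.
  have D : 'D_a (gauduchon t G theta (cst b) (cst u)) x =
      'D_a (fun y => Gam y b u) x
      + d_gauduchon_part (@J R n) (inner (G x)) t (T x) (Gam x) a b u.
    have [_ <-] := is_deriveD (Ckmx_is_derive a (weyl_Ckmx hermU 0 b u) Ux)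
      (is_derive_gauduchon_part a b u Ux).
    apply: near_eq_derive; apply: (near_U hermU Ux) => y Uy.
    exact: nabla_const.
  apply: etrans (gauduchon_weyl (cst a) _ Ux) _.
  change (cst a x) with a.
  move: D (nabla_const b u x Ux).
  generalize ('D_a (gauduchon t G theta (cst b) (cst u)) x).
  generalize (gauduchon t G theta (cst b) (cst u) x) => d1 d2 -> ->.
  have WD := weylD hermU a (Gam x b u) (A x b u) Ux.
  have AD := gauduchon_partP x a 1 (Gam x b u) (A x b u).
  rewrite -/Gam in WD; rewrite !scale1r in AD.
  have CE : curvature_part (@J R n) (inner (G x)) t (T x) (Gam x) a b u =
    d_gauduchon_part (@J R n) (inner (G x)) t (T x) (Gam x) a b u
    + Gam x a (A x b u) + A x a (Gam x b u) + A x a (A x b u) by [].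
  have AC (c d p q r s : V) :
      (c + d) + ((p + q) + (r + s)) = (c + p) + (d + q + r + s).
    by apply/rowP => i; rewrite !mxE; ring.
  apply: etrans (congr2 +%R erefl (congr2 +%R WD AD)) _.
  apply: etrans (AC _ _ _ _ _ _) _.
  exact: (congr2 +%R erefl (esym CE)).
have nabla0 : gauduchon t G theta (lie_bracket (cst e) (cst f)) (cst u) x = 0.
  rewrite gauduchon_weyl // derive_cst add0r /lie_bracket !derive_cst subrr.
  rewrite /Gam (weyl_sym hermU 0 _ Ux) (weyl0 hermU _ Ux) add0r /A.
  rewrite /gauduchon_part /lee_part /= (linear0 (@J R n)) !inner0l !inner0r.
  by rewrite !(mul0r, mulr0, scale0r, scaler0, subr0, addr0).
have AC (c p q c' p' q' : V) :
    (c + p + q) - (c' + p' + q') = (c - c' + p - p') + (q - q').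
  by apply/rowP => i; rewrite !mxE; ring.
rewrite /curvature nabla0 subr0.
apply: etrans (congr2 (fun c d => c - d) (nabla2 e f) (nabla2 f e)) _.
exact: AC.
Qed.

End GauduchonCurvature.

(** * Exterior derivatives of 2-forms on constant fields *)

Section ExteriorDerivative.
Context {R : realType} {n : nat}.
Local Notation V := 'rV[R]_(n + n).
Implicit Types (x u v w : V) (U : set V) (a : V -> V -> R)
  (rho : V -> V -> V -> R).

Lemma eq_d2 U rho rho' x u v w : open U -> U x ->
  (forall y p q, U y -> rho y p q = rho' y p q) ->
  d2 rho x u v w = d2 rho' x u v w.
Proof.
move=> oU Ux E.
have D e p q : 'D_e (fun y => rho y p q) x = 'D_e (fun y => rho' y p q) x.
  apply: near_eq_derive; apply: filterS (open_nbhs_nbhs (conj oU Ux)) => y Uy.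
  exact: E.
by rewrite /d2 (D u v w) (D v w u) (D w u v).
Qed.

Lemma d2_combination U (c1 c2 c3 : R) (r1 r2 r3 : V -> V -> V -> R) x u v w :
  U x -> (forall p q, Ck 0 U (fun y => r1 y p q)) ->
  (forall p q, Ck 0 U (fun y => r2 y p q)) ->
  (forall p q, Ck 0 U (fun y => r3 y p q)) ->
  d2 (fun y p q => c1 * r1 y p q + c2 * r2 y p q + c3 * r3 y p q) x u v w =
  c1 * d2 r1 x u v w + c2 * d2 r2 x u v w + c3 * d2 r3 x u v w.
Proof.
move=> Ux k1 k2 k3.
have D e p q : 'D_e (fun y => c1 * r1 y p q + c2 * r2 y p q + c3 * r3 y p q) x =
    c1 * 'D_e (fun y => r1 y p q) x + c2 * 'D_e (fun y => r2 y p q) x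
    + c3 * 'D_e (fun y => r3 y p q) x.
  have Dr r (kr : forall p q, Ck 0 U (fun y => r y p q)) c :=
    is_deriveZ c (derivableP (Ck_derivable (v := e) (kr p q) Ux)).
  have [_] := is_deriveD (is_deriveD (Dr r1 k1 c1) (Dr r2 k2 c2)) (Dr r3 k3 c3).
  exact.
rewrite /d2 (D u v w) (D v w u) (D w u v).
generalize ('D_u (fun y => r1 y v w) x) ('D_v (fun y => r1 y w u) x).
generalize ('D_w (fun y => r1 y u v) x) ('D_u (fun y => r2 y v w) x).
generalize ('D_v (fun y => r2 y w u) x) ('D_w (fun y => r2 y u v) x).
generalize ('D_u (fun y => r3 y v w) x) ('D_v (fun y => r3 y w u) x).
by generalize ('D_w (fun y => r3 y u v) x) => *; ring.
Qed.

Lemma d2_exact U a x u v w : open U -> U x ->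
  (forall p, Ck 2 U (fun y => a y p)) ->
  d2 (fun y p q => 'D_p (fun z => a z q) y - 'D_q (fun z => a z p) y) x u v w = 0.
Proof.
move=> oU Ux ak.
have D e p q : 'D_e (fun y => 'D_p (fun z => a z q) y - 'D_q (fun z => a z p) y) x =
    'D_e (fun y => 'D_p (fun z => a z q) y) x
    - 'D_e (fun y => 'D_q (fun z => a z p) y) x.
  have Da b c := derivableP (Ck_derivable (v := e) (Ck_derive b (ak c)) Ux).
  by have [_] := is_deriveB (Da p q) (Da q p).
have S b c p := @Ck_derive_comm _ _ U (fun z => a z p) x b c oU (ak p) Ux.
have AC (b1 b2 b3 c1 c2 c3 : R) : c1 = b1 -> c2 = b2 -> c3 = b3 ->
    (b1 - b2) + (b3 - c1) + (c2 - c3) = 0.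
  by move=> -> -> ->; ring.
apply: etrans (congr2 +%R (congr2 +%R (D u v w) (D v w u)) (D w u v)) _.
exact: AC (S v u w) (S w u v) (S w v u).
Qed.

End ExteriorDerivative.

(** * The Ricci form of the Weyl connection *)

Section LocalRicci.
Context {R : realType} {n : nat}.
Local Notation V := 'rV[R]_(n + n).
Variables (G : V -> 'M[R]_(n + n)) (theta : V -> V) (U : set V).
Implicit Types (x y e f u v w : V).
Hypothesis vaismanU : vaisman_on G theta U.

Let hermU : hermitian_on G theta U := vaisman_herm vaismanU.
Let oU : open U := herm_open hermU.
Let Gam := weyl G theta.

(* The trace of J against the Weyl connection: a local potential of the trace of
   J against the Weyl curvature, because J is constant in holomorphic charts and
   commutes with Gam. *)
Definition weyl_trace y v : R := \sum_k J (weyl G theta y v (delta_mx 0 k)) 0 k.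

Definition anti_lee_form y v : R := eval1 (theta y) (J v).

Definition lee_wedge y u v : R :=
  eval1 (theta y) u * eval1 (theta y) (J v)
  - eval1 (theta y) (J u) * eval1 (theta y) v.

Lemma weyl_trace_Ck k v : Ck k U (fun y => weyl_trace y v).
Proof.
apply: Ck_sum => // j.
apply: (@eq_Ck _ _ _ _ (fun y => (weyl G theta y v (delta_mx 0 j) *m
  lin1_mx (@J R n)) 0 j)) => //; first by move=> y _; rewrite J_mulmx.
apply: (Ckmx_mul oU _ (Ckmx_cst _ _ _)); exact: (weyl_Ckmx hermU).
Qed.

Lemma derive_weyl_trace x e v : U x ->
  'D_e (fun y => weyl_trace y v) x =
  \sum_k J ('D_e (fun y => weyl G theta y v (delta_mx 0 k)) x) 0 k.
Proof.
move=> Ux.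
have D k := is_derive_entry 0 k (is_derive_J (Ckmx_is_derive e
  (weyl_Ckmx hermU 0 v (delta_mx 0 k)) Ux)).
have [_ <-] := is_derive_sum D.
by congr (derive _ x e); apply/funext => y; rewrite fct_sumE.
Qed.

(** Both connection matrices commute with that of J, so cyclicity gives tr(J [Gam u, Gam v]) = 0:
    the quadratic part of R^D drops out of the trace. *)
Lemma weyl_commutator_trace x u v : U x ->
  \sum_k J (Gam x u (Gam x v (delta_mx 0 k))) 0 k =
  \sum_k J (Gam x v (Gam x u (delta_mx 0 k))) 0 k.
Proof.
move=> Ux; pose M a : 'M[R]_(n + n) := \matrix_k Gam x a (delta_mx 0 k).
pose j : 'M[R]_(n + n) := lin1_mx (@J R n).
have GM a w : Gam x a w = w *m M a.
  by apply: linear_matrix => c b d; exact: (weylP hermU).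
have Mj a : M a *m j = j *m M a.
  apply/row_matrixP => i; rewrite !rowE !mulmxA -GM -!J_mulmx -GM.
  exact: esym (weyl_J vaismanU _ _ Ux).
have tr a b : \sum_k J (Gam x a (Gam x b (delta_mx 0 k))) 0 k =
    \tr (M b *m M a *m j).
  apply: eq_bigr => k _.
  by rewrite J_mulmx !GM -!mulmxA -rowE mxE mulmxA.
apply: etrans (tr u v) (etrans _ (esym (tr v u))).
transitivity (\tr ((M u *m j) *m M v)); first by rewrite -mulmxA mxtrace_mulC.
transitivity (\tr (M u *m (j *m M v))); first by rewrite mulmxA.
by rewrite -(Mj v) mulmxA.
Qed.

Lemma weyl_curvature_pair x a b c d : U x ->
  inner (G x) (weyl_curvature G theta x a b c) d =
  inner (G x) (weyl_curvature G theta x c d a) b.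
Proof.
move=> Ux; apply: (curvature_pair_symmetry (rm := fun a b c d =>
  inner (G x) (weyl_curvature G theta x a b c) d)) => {a b c d} a b c d.
- by rewrite [weyl_curvature _ _ _ a b c]weyl_curvature_skew innerNl.
- exact: (weyl_curvature_skewr vaismanU).
- have B := weyl_bianchi hermU a b c Ux.
  have S (p q r : V) : inner (G x) p d + inner (G x) q d + inner (G x) r d =
      inner (G x) (p + q + r) d by rewrite !innerDl.
  by apply: etrans (S _ _ _) _; rewrite B inner0l.
Qed.

Lemma weyl_ricci x u v (E := orthonormal_basis (G x)) : U x ->
  \sum_i inner (G x) (weyl_curvature G theta x (row i E) (J (row i E)) u) v =
  - ('D_u (fun y => weyl_trace y v) x - 'D_v (fun y => weyl_trace y u) x).
Proof.
move=> Ux; pose L w := J (weyl_curvature G theta x u v w).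
have LP c a b : L (c *: a + b) = c *: L a + L b.
  by rewrite /L (weyl_curvature_linear vaismanU) // linearP.
rewrite (eq_bigr (fun i => - inner (G x) (row i E *m \matrix_k L (delta_mx 0 k))
  (row i E))); last first.
  move=> i _; rewrite (weyl_curvature_pair _ _ _ _ Ux) -linear_matrix //.
  by rewrite /L (metric_Jl hermU) // opprK.
rewrite sumrN orthonormal_basis_trace; last 2 first.
- by move=> a b; exact: (herm_sym hermU).
- by move=> a; exact: (herm_pos hermU).
congr (- _).
transitivity (\sum_k (J ('D_u (fun y => Gam y v (delta_mx 0 k)) x) 0 k
    - J ('D_v (fun y => Gam y u (delta_mx 0 k)) x) 0 k
    + (J (Gam x u (Gam x v (delta_mx 0 k))) 0 k
       - J (Gam x v (Gam x u (delta_mx 0 k))) 0 k))).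
  apply: eq_bigr => k _; rewrite mxE.
  have JB (a b c d : V) :
      J (a - b + c - d) 0 k = J a 0 k - J b 0 k + (J c 0 k - J d 0 k).
    by rewrite linearB linearD linearB !mxE addrA.
  exact: JB.
rewrite big_split /= !sumrB.
have AC (a b c d : R) : c = d -> a - b + (c - d) = a - b.
  by move=> ->; rewrite subrr addr0.
apply: etrans (AC _ _ _ _ (weyl_commutator_trace u v Ux)) _.
exact: (congr2 (fun a b => a - b) (esym (derive_weyl_trace u v Ux))
  (esym (derive_weyl_trace v u Ux))).
Qed.

End LocalRicci.

(** * The second Ricci form and its exterior derivative *)

Section LocalRicciForm.
Context {R : realType} {n : nat}.
Local Notation V := 'rV[R]_(n + n).
Variables (G : V -> 'M[R]_(n + n)) (theta : V -> V) (U : set V) (t : R).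
Implicit Types (x y e f u v w : V).
Hypothesis vaismanU : vaisman_on G theta U.

Let hermU : hermitian_on G theta U := vaisman_herm vaismanU.
Let oU : open U := herm_open hermU.
Let T := sharp G theta.
Let Gam := weyl G theta.
Let s := (1 - t) / 4.
Let N : R := (n + n)%:R.
(** With N = 2 n, [kappa] and [mu] are the coefficients of d eta and of theta /\ eta in the traced
    curvature difference. *)
Let kappa := 4 * s ^+ 2 - 4 * s - t / 2 * (N - 2).
Let mu := (N - 2) * (1 + t) ^+ 2 / 8.

Let d_weyl_trace y u v : R :=
  'D_u (fun z => weyl_trace G theta z v) y - 'D_v (fun z => weyl_trace G theta z u) y.

Let d_anti_lee y u v : R :=
  'D_u (fun z => anti_lee_form theta z v) y - 'D_v (fun z => anti_lee_form theta z u) y.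

Lemma derive_anti_lee x e u : U x ->
  'D_e (fun y => anti_lee_form theta y u) x =
  dtheta (inner (G x)) (T x) (Gam x) e (J u).
Proof. by move=> Ux; rewrite (derive_eval1 hermU) // (derive_form vaismanU). Qed.

Lemma d_anti_leeE x u v : U x ->
  d_anti_lee x u v = lee_wedge theta x u v
    + inner (G x) (T x) (T x) * inner (G x) (J u) v.
Proof.
move=> Ux; rewrite /d_anti_lee !derive_anti_lee // /lee_wedge.
rewrite -!(inner_sharp hermU _ Ux).
apply: (dtheta_J_alternate (J := @J R n) (g := inner (G x))).
- by move=> a b; exact: (herm_sym hermU).
- by move=> *; exact: innerZl.
- exact: JJ.
- by move=> *; exact: (herm_J hermU).
- by move=> a b; exact: (weyl_sym hermU).
- by move=> a b; exact: (weyl_J vaismanU).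
Qed.

Lemma ricci2E x u v : U x ->
  ricci2 t G theta x u v =
  2^-1 * d_weyl_trace x u v + (- (kappa / 2)) * d_anti_lee x u v
  + (- (mu / 2)) * lee_wedge theta x u v.
Proof.
move=> Ux.
have GC a b : inner (G x) a b = inner (G x) b a by exact: (herm_sym hermU).
have Gpos a : a != 0 -> 0 < inner (G x) a a by exact: (herm_pos hermU).
have curv i (e := row i (orthonormal_basis (G x))) :
    inner (G x) (curvature (gauduchon t G theta) (cst e) (cst (J e)) (cst u) x) v =
    inner (G x) (weyl_curvature G theta x e (J e) u) v +
    inner (G x) (curvature_part (@J R n) (inner (G x)) t (T x) (Gam x) e (J e) u
      - curvature_part (@J R n) (inner (G x)) t (T x) (Gam x) (J e) e u) v.
  have C := gauduchon_curvature t vaismanU e (J e) u Ux.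
  apply: etrans (congr1 (fun z => inner (G x) z v) C) _.
  exact: innerDl.
have trace := @curvature_difference_trace _ _ (@J R n) (inner (G x)) GC
  (innerDl (G x)) (innerZl (G x)) (@JJ R n) (fun a b => herm_J hermU a b Ux)
  t (T x) (Gam x) (fun a b => weyl_sym hermU a b Ux)
  (fun a b c => weylD hermU a b c Ux) (fun c a b => weylZ hermU c a b Ux)
  (fun a b => weyl_J vaismanU a b Ux) _
  (fun i => row i (orthonormal_basis (G x))) N u v
  (orthonormal_basis_parseval GC Gpos) (orthonormal_basis_dim GC Gpos).
have AC (a b w : R) : - 2^-1 * (- a + (kappa * b + mu * w)) =
  2^-1 * a + (- (kappa / 2)) * b + (- (mu / 2)) * w by field.
apply: (etrans _ (AC _ _ _)); apply: (congr1 (fun z => - 2^-1 * z)).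
apply: etrans (eq_bigr _ (fun i _ => curv i)) _.
rewrite big_split /=; apply: (congr2 +%R).
  exact: (weyl_ricci vaismanU u v Ux).
apply: etrans trace _.
rewrite d_anti_leeE // /lee_wedge -!(inner_sharp hermU _ Ux).
by [].
Qed.

Lemma d_weyl_trace_Ck p q : Ck 0 U (fun y => d_weyl_trace y p q).
Proof. by apply: CkB => //; apply: Ck_derive; exact: (weyl_trace_Ck vaismanU). Qed.

Lemma anti_lee_Ck k p : Ck k U (fun y => anti_lee_form theta y p).
Proof. exact: (eval1_Ck hermU). Qed.

Lemma d_anti_lee_Ck p q : Ck 0 U (fun y => d_anti_lee y p q).
Proof. by apply: CkB => //; apply: Ck_derive; exact: anti_lee_Ck. Qed.

Lemma lee_wedge_Ck k p q : Ck k U (fun y => lee_wedge theta y p q).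
Proof. by apply: CkB => //; apply: CkM => //; exact: (eval1_Ck hermU). Qed.

Lemma d2_lee_wedge x u v w : U x ->
  d2 (lee_wedge theta) x u v w =
  - inner (G x) (T x) (T x) * (inner (G x) (T x) u * inner (G x) (J v) w
    + inner (G x) (T x) v * inner (G x) (J w) u
    + inner (G x) (T x) w * inner (G x) (J u) v).
Proof.
move=> Ux.
pose dth := dtheta (inner (G x)) (T x) (Gam x).
have D e a b : 'D_e (fun y => lee_wedge theta y a b) x =
    (dth e a * inner (G x) (T x) (J b) + inner (G x) (T x) a * dth e (J b))
    - (dth e (J a) * inner (G x) (T x) b + inner (G x) (T x) (J a) * dth e b).
  have Dth c := is_derive_eval1_const c
    (Ckmx_is_derive e (form_Ckmx hermU 0) Ux).
  have [_ E] := is_deriveB (is_deriveM (Dth a) (Dth (J b)))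
    (is_deriveM (Dth (J a)) (Dth b)).
  have dE c : dth e c = eval1 ('D_e theta x) c by rewrite (derive_form vaismanU).
  apply: etrans E _; rewrite (dE a) (dE b) (dE (J a)) (dE (J b)).
  rewrite !(inner_sharp hermU _ Ux).
  generalize (eval1 (theta x) a) (eval1 (theta x) b).
  generalize (eval1 (theta x) (J a)) (eval1 (theta x) (J b)).
  generalize (eval1 ('D_e theta x) a) (eval1 ('D_e theta x) b).
  generalize (eval1 ('D_e theta x) (J a)) (eval1 ('D_e theta x) (J b)).
  move=> q1 q2 q3 q4 q5 q6 q7 q8; rewrite /GRing.scale /=.
  by ring.
rewrite /d2 (D u v w) (D v w u) (D w u v).
apply: (@dtheta_wedge _ _ (@J R n) (inner (G x))).
- by move=> a b; exact: (herm_sym hermU).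
- by move=> *; exact: innerZl.
- exact: JJ.
- by move=> *; exact: (herm_J hermU).
- by move=> a b; exact: (weyl_sym hermU).
- by move=> a b; exact: (weyl_J vaismanU).
Qed.

Lemma d2_ricci2 x u v w : U x ->
  d2 (ricci2 t G theta) x u v w = - (mu / 2) * d2 (lee_wedge theta) x u v w.
Proof.
move=> Ux.
rewrite (eq_d2 u v w oU Ux (fun y p q => @ricci2E y p q)).
rewrite (d2_combination _ _ _ u v w Ux d_weyl_trace_Ck d_anti_lee_Ck (lee_wedge_Ck 0)).
have Z1 := d2_exact u v w oU Ux (weyl_trace_Ck vaismanU 2).
have Z2 := d2_exact u v w oU Ux (anti_lee_Ck 2).
rewrite [X in _ * X + _ + _]Z1 [X in _ + _ * X + _]Z2.
by rewrite !mulr0 !add0r.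
Qed.

Lemma ricci2_not_closed x : (2 <= n)%N -> U x -> theta x != 0 ->
  (forall u v w, d2 (ricci2 t G theta) x u v w = 0) -> t = -1.
Proof.
move=> n2 Ux thx closed.
pose j : 'M[R]_(n + n) := lin1_mx (@J R n).
pose M : 'M[R]_(n + n, 1 + 1) := row_mx (theta x)^T (j *m (theta x)^T).
(* The columns of M encode theta and theta o J. They impose two conditions on a space of dimension n
   + n >= 4, and since vectors are rows, v is taken in the left kernel. *)
have : kermx M != 0.
  rewrite kermx_eq0 /row_free ltn_eqF // (leq_ltn_trans (rank_leq_col M)) //.
  by rewrite (leq_trans _ (leq_add n2 n2)).
move=> /rowV0Pn[v /sub_kermxP vM v0].
have [v1 v2] : eval1 (theta x) v = 0 /\ eval1 (theta x) (J v) = 0.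
  move: vM; rewrite mul_mx_row => vM; split.
    have := congr1 (@lsubmx _ 1 1 1) vM; rewrite row_mxKl -eval1E => ->.
    by rewrite !mxE.
  have := congr1 (@rsubmx _ 1 1 1) vM; rewrite row_mxKr mulmxA -J_mulmx.
  by rewrite -eval1E => ->; rewrite !mxE.
have T0 : T x != 0.
  apply/eqP => T0; case/eqP: thx; apply/rowP => i.
  have := inner_sharp hermU (delta_mx 0 i) Ux; rewrite -/T T0 inner0l.
  by rewrite -eval1E -rowE !mxE => <-.
have l0 : 0 < inner (G x) (T x) (T x) by exact: (herm_pos hermU).
have gv0 : 0 < inner (G x) v v by exact: (herm_pos hermU).
(* Of theta /\ omega on these vectors only theta(theta#) omega(v, J v) = |theta|^2 g(v, v) survives,
   which is positive; hence [mu] = 0. *)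
have := closed (T x) v (J v); rewrite d2_ricci2 // d2_lee_wedge //.
rewrite !(inner_sharp hermU v) // !(inner_sharp hermU (J v)) // v1 v2 !mul0r.
rewrite (herm_J hermU) // !addr0.
have cancel (m a b : R) : 0 < a -> 0 < b -> - (m / 2) * (- a * (a * b)) = 0 -> m = 0.
  move=> a0 b0 /eqP; rewrite !(mulf_eq0, oppr_eq0, gt_eqF a0, gt_eqF b0) !orbF.
  by rewrite invr_eq0 pnatr_eq0 orbF => /eqP.
move=> /(cancel _ _ _ l0 gv0) /eqP.
have N2 : N - 2 != 0.
  by rewrite subr_eq0 eqr_nat gtn_eqF // (leq_trans _ (leq_add n2 n2)).
rewrite /mu !mulf_eq0 (negPf N2) invr_eq0 pnatr_eq0 orbF /= orbb => /eqP.
by move=> t1; lra.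
Qed.

End LocalRicciForm.

Theorem theorem5p1 (R : realType) (n : nat) (hn : (2 <= n)%N)
    (M : topologicalType) (hausdorffM : hausdorff_space M)
    (countableM : @second_countable M) (connectedM : connected [set: M])
    (A : complex_atlas R n M)
    (g : chart A -> 'rV[R]_(n + n) -> 'M[R]_(n + n))
    (theta : chart A -> 'rV[R]_(n + n) -> 'rV[R]_(n + n))
    (vaismanM : vaisman g theta) (t : R) :
  closed_two_form (gauduchon_ricci2 t g theta) <-> t = -1.
Proof.
have [[[gs _ gsym gpos gJ] [ths _] _ lck] par [c0 [x0 [Ux0 thx0]]]] := vaismanM.
have local c : vaisman_on (g c) (theta c) (cod c).
  split; [split|exact: lck|exact: par].
  - exact: cod_open.
  - exact: gs.
  - exact: ths.
  - by move=> x u v; exact: gsym.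
  - by move=> x u; exact: gpos.
  - by move=> x u v; exact: gJ.
split=> [closed|-> c x u v w Ux].
  (* One chart and one point where theta is nonzero suffice for this direction. *)
  apply: (ricci2_not_closed (local c0) hn Ux0 thx0) => u v w.
  exact: closed.
rewrite /gauduchon_ricci2 (d2_ricci2 _ (local c)) //.
by rewrite subrr expr0n /= !(mulr0, mul0r) oppr0 mul0r.
Qed.
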